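(* Let $1<p\le 2$, and let $\mathcal L$, $\mu$, $\nu$, $b$ and the two weight paraproduct $\pi_b^{\mu,\nu}$ be as in the context. There is a finite constant $A$ such that $$\|\pi_b^{\mu,\nu} f\|_{L^p(\nu)}^p\le A^p\|f\|_{L^p(\mu)}^p\qquad\text{for all } f\in L^p(\mu)$$ if and only if there is a finite constant $B$ such that for all $J\in\mathcal L$ $$\int_J\Bigl|\sum_{I\in\mathcal L(J)}\Delta_I^\nu b\Bigr|^p\,d\nu\le B^p\mu(J).$$ Moreover, the best constants $A$, $B$ in these inequalities satisfy $c(p)B\le A\le C(p)B$, where $0<c(p)\le C(p)<\infty$ depend only on $p$.
   Context: Setup. $(\mathcal X,\mathfrak S)$ is a measurable space carrying a $\sigma$-finite measure $\mu$ and a filtration, i.e. an increasing sequence of $\sigma$-algebras $\mathfrak S_n\subset\mathfrak S_{n+1}\subset\mathfrak S$, $n\in\mathbb Z$. Each $\mathfrak S_n$ is atomic: there is a countable collection $\mathcal L_n$ of disjoint sets of finite measure (atoms, also called intervals) such that each $A\in\mathfrak S_n$ is a union of sets from $\mathcal L_n$; thus each $I\in\mathcal L_n$ is an at most countable union of elements of $\mathcal L_{n+1}$. Put $\mathcal L=\bigcup_{n\in\mathbb Z}\mathcal L_n$. An atom may belong to several, even infinitely many, $\mathcal L_n$, but not to all of them. $\mu,\nu$ are measures on $(\mathcal X,\mathfrak S)$ that are locally finite, i.e. finite on every $I\in\mathcal L$. For $I\in\mathcal L$, $\operatorname{rk} I=\sup\{n: I\in\mathcal L_n\}\in\mathbb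 Z\cup\{+\infty\}$. If $\operatorname{rk} I=n<\infty$, the children of $I$ are $\operatorname{ch}(I)=\{I'\in\mathcal L_{n+1}: I'\subset I\}$; if $\operatorname{rk} I=\infty$, $\operatorname{ch}(I)=\{I\}$. For $J\in\mathcal L$, $\mathcal L(J)=\{I\in\mathcal L: I\subset J\}$. For a locally finite measure $\sigma$, $\langle f\rangle_{I,\sigma}=\sigma(I)^{-1}\int_I f\,d\sigma$ (and $\langle f\rangle_{I,\sigma}=0$ if $\sigma(I)=0$), $\mathbb E_I^\sigma f=\langle f\rangle_{I,\sigma}\mathbf 1_I$, and $\Delta_I^\sigma f=\sum_{I'\in\operatorname{ch}(I)}\mathbb E_{I'}^\sigma f-\mathbb E_I^\sigma f$. The symbol $b$ is a function $\nu$-integrable on each $I\in\mathcal L$; more generally $b$ may be just a collection $\{b_I\}_{I\in\mathcal L}$ of ''martingale differences'', where each $b_I$ is $\nu$-integrable, supported on $I$, constant on each child of $I$ and satisfies $\int_I b_I\,d\nu=0$, in which case $\Delta_I^\nu b$ denotes $b_I$. The two weight paraproduct is $$\pi_b^{\mu,\nu}f=\sum_{I\in\mathcal L}(\mathbb E_I^\mu f)(\Delta_I^\nu b),$$ each atom $I$ being counted once. Infinite sums of martingale differences are understood as unconditionally convergent in $L^p(\nu)$, convergence being part of the assertion that an inequality involving such a sum holds.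
   Formalization: The formal theorem additionally assumes that Δ_I^ν b = 0 ν-a.e. for every atom I with μ(I) = 0; without this the boundedness of the paraproduct does not imply the testing condition, since averages over μ-null atoms are 0 by convention. *)

(* Defs.v *)
From HB Require Import structures.
From mathcomp Require Import all_boot all_order all_algebra.
From mathcomp Require Import all_classical all_reals all_analysis.

Set Implicit Arguments.
Unset Strict Implicit.
Unset Printing Implicit Defensive.
Import Order.TTheory GRing.Theory Num.Theory.
Import numFieldNormedType.Exports.

Local Open Scope classical_set_scope.
Local Open Scope ring_scope.

Section AtomicFiltration.
Context {d : measure_display} {X : measurableType d}.

Record atomic_sigma_algebra (S L : set (set X)) : Prop := {
  asa_sigma : sigma_algebra [set: X] S ;
  asa_sub : S `<=` measurable ;
  asa_countable : countable L ;
  asa_disjoint : trivIset L id ;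
  asa_nonempty : forall I, L I -> I !=set0 ;
  asa_atoms : L `<=` S ;
  asa_union : forall A, S A -> exists2 L' : set (set X),
    L' `<=` L & A = \bigcup_(I in L') I }.

Record atomic_filtration (S L : int -> set (set X)) : Prop := {
  af_atomic : forall n, atomic_sigma_algebra (S n) (L n) ;
  af_incr : forall n, S n `<=` S (n + 1) ;
  af_not_all : forall I : set X, ~ (forall n, L n I) }.

Definition atoms (L : int -> set (set X)) : set (set X) := \bigcup_n L n.

Definition atoms_in (L : int -> set (set X)) (J : set X) : set (set X) :=
  [set I | atoms L I /\ I `<=` J].

Definition locally_finite {R : realType} (L : int -> set (set X))
    (sigma : {measure set X -> \bar R}) : Prop :=
  forall I, atoms L I -> (sigma I < +oo)%E.

End AtomicFiltration.

Section Paraproduct.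
Context {d : measure_display} {X : measurableType d} {R : realType}.
Implicit Types (L : int -> set (set X)) (sigma mu nu : {measure set X -> \bar R}).

(* Valued in \bar R so as to be the actual supremum; it is -oo off [atoms L]. *)
Definition rk L (I : set X) : \bar R :=
  ereal_sup [set (n%:~R)%:E | n in [set n : int | L n I]].

Definition children L (I : set X) : set (set X) :=
  [set I' | (rk L I = +oo%E /\ I' = I) \/
     exists n : int, [/\ rk L I = (n%:~R)%:E, L (n + 1) I' & I' `<=` I]].

(* Equals 0 when [sigma I = 0], since 0^-1 = 0. *)
Definition average sigma (f : X -> R) (I : set X) : R :=
  (fine (sigma I))^-1 * \int[sigma]_(x in I) f x.

Definition expect sigma (f : X -> R) (I : set X) : X -> R :=
  fun x => average sigma f I * \1_I x.

(* The children of an atom being pairwise disjoint, at most one summand is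
   nonzero at each point, so that the finitely supported sum [\sum_(_ \in _)]
   is the full sum even when there are infinitely many children. *)
Definition mdiff L sigma (f : X -> R) (I : set X) : X -> R :=
  fun x => (\sum_(I' \in children L I) expect sigma f I' x)
           - expect sigma f I x.

Record mdiff_family L nu (b : set X -> X -> R) : Prop := {
  mdf_integrable : forall I, atoms L I -> nu.-integrable [set: X] (EFin \o b I) ;
  mdf_support : forall I x, atoms L I -> ~ I x -> b I x = 0 ;
  mdf_const : forall I I' x y, atoms L I -> children L I I' ->
    I' x -> I' y -> b I x = b I y ;
  mdf_mean0 : forall I, atoms L I -> \int[nu]_(x in I) b I x = 0 }.

Inductive symbol : Type :=
  | FunSymbol of X -> R
  | FamilySymbol of set X -> X -> R.

Definition is_symbol L nu (b : symbol) : Prop :=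
  match b with
  | FunSymbol f => forall I, atoms L I -> nu.-integrable I (EFin \o f)
  | FamilySymbol g => mdiff_family L nu g
  end.

Definition delta L nu (b : symbol) (I : set X) : X -> R :=
  match b with
  | FunSymbol f => mdiff L nu f I
  | FamilySymbol g => g I
  end.

(* The series of the [h I], I in D, converges unconditionally in L^p(nu) to s:
   convergence along the net of finite subsets of D. *)
Definition uncond_sum nu (p : R) (D : set (set X)) (h : set X -> X -> R)
    (s : X -> R) : Prop :=
  [/\ forall I, D I -> h I \in Lfun nu p%:E,
      s \in Lfun nu p%:E &
      forall eps : R, 0 < eps -> exists F0 : set (set X),
        [/\ finite_set F0, F0 `<=` D &
          forall F : set (set X), finite_set F -> F0 `<=` F -> F `<=` D ->
            ('N[nu]_(p%:E)[EFin \o (fun x => (\sum_(I \in F) h I x) - s x)%R]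
               < eps%:E)%E]].

(* The sum is determined up to nu-a.e. equality. *)
Definition is_paraproduct L mu nu (b : symbol) (p : R) (f s : X -> R) : Prop :=
  uncond_sum nu p (atoms L) (fun I x => expect mu f I x * delta L nu b I x) s.

Definition paraproduct_bound L mu nu (b : symbol) (p A : R) : Prop :=
  forall f : X -> R, f \in Lfun mu p%:E ->
    exists2 s : X -> R, is_paraproduct L mu nu b p f s &
      ('N[nu]_(p%:E)[EFin \o s] `^ p
         <= (A `^ p)%:E * 'N[mu]_(p%:E)[EFin \o f] `^ p)%E.

Definition testing_bound L mu nu (b : symbol) (p B : R) : Prop :=
  forall J, atoms L J ->
    exists2 s : X -> R, uncond_sum nu p (atoms_in L J) (delta L nu b) s &
      (\int[nu]_(x in J) (`|s x| `^ p)%:E <= (B `^ p)%:E * mu J)%E.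

(* [+oo] when no constant satisfies [P]. *)
Definition best_const (P : R -> Prop) : \bar R :=
  ereal_inf [set A%:E | A in [set A : R | 0 <= A /\ P A]].

(* On an atom with [mu I = 0] the average of f is 0 by convention, so the
   paraproduct does not see [delta L nu b I], whereas the testing condition
   does (and forces it to vanish nu-a.e.). *)
Definition vanishes_on_null_atoms L mu nu (b : symbol) : Prop :=
  forall I, atoms L I -> mu I = 0%E -> {ae nu, forall x, delta L nu b I x = 0}.

End Paraproduct.

Arguments symbol {d} X R.

(* Main.v *)
From HB Require Import structures.
Require Import Defs.
From mathcomp Require Import all_boot all_order all_algebra finmap.
From mathcomp Require Import all_classical all_reals all_analysis.
From mathcomp Require Import measurable_realfun ring lra zify.
Import Order.TTheory GRing.Theory Num.Theory.
Import numFieldNormedType.Exports.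

Set Implicit Arguments.
Unset Strict Implicit.
Unset Printing Implicit Defensive.

Local Open Scope classical_set_scope.
Local Open Scope ring_scope.

(** The theorem reduces to statements about square functions.  For a finite
    family F of martingale differences h_I let S_F be the square root of the
    sum of the h_I^2, I in F.

    For 1 < p <= 2 the integrals of S_F^p and of |sum of the h_I|^p are
    comparable ([square_integral_le_power_integral],
    [power_integral_le_square_integral]).  Both halves come from one Bellman
    function argument.  Put V(x, s) = (x^2 + s)^(p/2) - K w^p, where x is the
    current sum, s the current sum of squares, and w is |x| or s^(1/2).
    Because p <= 2, the second order growth of (x^2 + s)^(p/2) under a step
    (x, s) -> (x + t, s + t^2) is at most a constant times that of w^p; so for
    a suitable K the function V lies below a linear function of t, namely
    V(x, s) + A t.  Adding the differences from the coarsest atoms to the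
    finest, the slope A is constant on the atom of the difference being added,
    so A t integrates to 0.  In the end V is bounded above by a function of
    integral 0, and this gives the inequality between the integrals.

    It follows that the finite subfamilies of an unconditionally convergent
    series have uniformly bounded square functions
    ([square_integral_le_uncond_sum]).  Conversely such a bound forces
    convergence ([uncond_sum_of_square_integral]): if F0 nearly maximizes the
    integral of S_F0^p, then every family disjoint from F0 has a small square
    function, since (u + v)^(p/2) - u^(p/2) controls v^(p/2).

    Necessity of the testing condition: apply the paraproduct to the indicator
    of J.  Its averages are 1 over the atoms inside J, apart from those of mu
    measure 0, whose differences vanish by assumption.  So the paraproduct and
    the testing sum have the same square function over these atoms.

    Sufficiency: the coefficients of the differences are the averages of f.
    Group the atoms by the size of their average, in steps of a factor 2.
    Since t^(p/2) is subadditive, the groups can be estimated one by one.  In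
    the group at height l the coefficients are at most l, so the testing
    condition on its maximal atoms J bounds the contribution by a constant
    times l^p times the sum of the mu(J); the averages being larger than l/2,
    each mu(J) is at most the integral over J of the positive part of
    4|f|/l - 1.  The J are disjoint and the sum over the heights l < 4|f| is
    geometric, which gives a multiple of the integral of |f|^p
    ([carleson_embedding]). *)

(** * Inequalities between powers *)

Section power_inequalities.
Context {R : realType}.
Implicit Types a b c h p q r s x y : R.

(** A rearrangement of the weighted inequality between arithmetic and
    geometric means, a^q b^(1-q) <= q a + (1-q) b. *)
Lemma powR_concave_tangent q a b : 0 < q -> q <= 1 -> 0 <= a -> 0 < b ->
  a `^ q <= b `^ q + q * b `^ (q - 1) * (a - b).
Proof.
move=> q0 q1 a0 b0.
have bq0 : 0 < b `^ (q - 1) by exact: powR_gt0.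
have bE : b `^ q = b * b `^ (q - 1) by rewrite mulr_powRB1 // ltW.
move: q1; rewrite le_eqVlt => /predU1P[->|q1].
  by rewrite subrr powRr0 !powRr1 ?(ltW b0)//; lra.
have q'0 : 0 < 1 - q by lra.
have H := @conjugate_powR R (a `^ q) (b `^ (1 - q)) q^-1 (1 - q)^-1
  (powR_ge0 _ _) (powR_ge0 _ _).
rewrite !invr_gt0 !invrK in H; have {H} := H q0 q'0 (subrKC _ _).
rewrite -!powRrM !mulfV ?gt_eqF // !powRr1 ?(ltW b0) // => H.
have -> : a `^ q = a `^ q * b `^ (1 - q) * b `^ (q - 1).
  rewrite -mulrA -powRD; last by rewrite (gt_eqF b0) implybT.
  by rewrite (_ : 1 - q + (q - 1) = 0) ?powRr0 ?mulr1 //; ring.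
apply: (le_trans (ler_wpM2r (ltW bq0) H)); rewrite bE.
by rewrite le_eqVlt; apply/orP; left; apply/eqP; ring.
Qed.

Lemma powR_le_anti e a b : e <= 0 -> 0 < a -> a <= b -> b `^ e <= a `^ e.
Proof.
move=> e0 a0 ab; rewrite -(opprK e) !(powRN _ (- e)) lef_pV2 ?posrE ?powR_gt0 //; last first.
  exact: lt_le_trans a0 ab.
by apply: ge0_ler_powR; rewrite ?nnegrE; lra.
Qed.

Lemma normr_powR x p : `|x| `^ p = (x ^+ 2) `^ (p / 2).
Proof.
by rewrite -[in RHS]real_normK ?num_real // -powR_mulrn // -powRrM mulrCA mulfV ?mulr1.
Qed.

Lemma powR_subadd q a b : 0 < q -> q <= 1 -> 0 <= a -> 0 <= b ->
  (a + b) `^ q <= a `^ q + b `^ q.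
Proof.
move=> q0 q1; rewrite le_eqVlt => /predU1P[<-|a0].
  by rewrite add0r powR0 ?gt_eqF // add0r.
rewrite le_eqVlt => /predU1P[<-|b0].
  by rewrite addr0 powR0 ?gt_eqF // addr0.
have ab0 : 0 < a + b by lra.
have le1 c : 0 < c -> c <= a + b -> c * (a + b) `^ (q - 1) <= c `^ q.
  move=> c0 cab; rewrite -(@mulr_powRB1 _ c) ?(ltW c0) // ler_wpM2l ?(ltW c0) //.
  by apply: powR_le_anti => //; lra.
rewrite -(@mulr_powRB1 _ (a + b)) ?(ltW ab0) // mulrDl.
by apply: lerD; apply: le1 => //; lra.
Qed.

Lemma powR_double q a : 0 < q -> q <= 1 -> 0 <= a ->
  (2 * a) `^ q <= 2 * a `^ q.
Proof.
by move=> q0 q1 a0; rewrite !mulr_natl !mulr2n; apply: powR_subadd.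
Qed.

Section exponent.
Variable p : R.
Hypotheses (p1 : 1 < p) (p2 : p <= 2).

(** The remainder of the tangent at x is at least (p-1)(u-x)(u^(p-1)-x^(p-1)),
    and t^(p-1) is concave because p <= 2, so that its increments are at least
    those of its tangent at the larger of the two points. *)
Lemma powR_uniform_convex u x : 0 <= u -> 0 <= x ->
  x `^ p + p * x `^ (p - 1) * (u - x)
    + (p - 1) ^+ 2 * (Num.max u x) `^ (p - 2) * (u - x) ^+ 2 <= u `^ p.
Proof.
move=> u0 x0; have P1 := p1; have P2 := p2.
have P0 : 0 < p by lra. have Q0 : 0 < p - 1 by lra.
have e1 : p - 1 - 1 = p - 2 by ring.
have Z e : 0 < e -> 0 `^ e = 0 :> R by move=> e0; rewrite powR0 // gt_eqF.
move: u0 x0; rewrite le_eqVlt => /predU1P[<-|u0].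
  rewrite le_eqVlt => /predU1P[<-|x0].
    by rewrite !Z // subrr expr0n /= !mulr0 !addr0.
  rewrite (max_idPr (ltW x0)) Z //.
  have E1 : x `^ p = x ^+ 2 * x `^ (p - 2).
    by rewrite expr2 -mulrA -e1 !mulr_powRB1 ?(ltW x0) //.
  have E2 : x `^ (p - 1) * x = x ^+ 2 * x `^ (p - 2).
    by rewrite expr2 -mulrA -e1 mulr_powRB1 ?(ltW x0) // mulrC.
  rewrite E1 -subr_ge0.
  have -> : 0 - (x ^+ 2 * x `^ (p - 2) + p * x `^ (p - 1) * (0 - x) +
     (p - 1) ^+ 2 * x `^ (p - 2) * (0 - x) ^+ 2) = (p - 1) * (2 - p) * (x ^+ 2 * x `^ (p - 2)).
    have -> : p * x `^ (p - 1) * (0 - x) = - p * (x ^+ 2 * x `^ (p - 2)) by rewrite -E2; ring.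
    by ring.
  by rewrite !mulr_ge0 ?sqr_ge0 ?powR_ge0 //; lra.
rewrite le_eqVlt => /predU1P[<-|x0].
  rewrite (max_idPl (ltW u0)) !Z //.
  have E1 : u `^ p = u ^+ 2 * u `^ (p - 2).
    by rewrite expr2 -mulrA -e1 !mulr_powRB1 ?(ltW u0) //.
  rewrite E1 mulr0 mul0r !add0r subr0 -mulrA (mulrC (u `^ _)).
  rewrite -[leRHS]mul1r; apply: ler_wpM2r; first by rewrite mulr_ge0 ?sqr_ge0 ?powR_ge0.
  by rewrite expr_le1 //; lra.
have T1 := @powR_concave_tangent (p - 1) x u Q0 _ (ltW x0) u0.
have T2 := @powR_concave_tangent (p - 1) u x Q0 _ (ltW u0) x0.
have Q1 : p - 1 <= 1 by lra.
move/(_ Q1) : T1; move/(_ Q1): T2; rewrite e1 => T2 T1.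
rewrite -(@mulr_powRB1 _ u) ?(ltW u0) // -(@mulr_powRB1 _ x p) ?(ltW x0) //.
have Eu : u * u `^ (p - 2) = u `^ (p - 1) by rewrite -e1 mulr_powRB1 ?(ltW u0).
have D1 : (p - 1) * (u - x) * (u `^ (p - 1) - x `^ (p - 1)) <=
   u * u `^ (p - 1) - x * x `^ (p - 1) - p * x `^ (p - 1) * (u - x).
  have := ler_wpM2l (ltW u0) T1; rewrite mulrDr.
  have -> : u * ((p - 1) * u `^ (p - 2) * (x - u)) =
    (p - 1) * (x - u) * u `^ (p - 1) by rewrite -Eu; ring.
  rewrite -subr_ge0 -[in X in _ -> X]subr_ge0 => H; apply: le_trans H _.
  by rewrite le_eqVlt; apply/orP; left; apply/eqP; ring.
have D2 : (p - 1) * (Num.max u x) `^ (p - 2) * (u - x) ^+ 2 <=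
    (u - x) * (u `^ (p - 1) - x `^ (p - 1)).
  have [xu|ux] := leP x u.
    rewrite -subr_ge0 (_ : _ - _ = (u - x) * (u `^ (p - 1) - x `^ (p - 1)
      - (p - 1) * u `^ (p - 2) * (u - x))); last by ring.
    by apply: mulr_ge0; lra.
  rewrite -subr_ge0 (_ : _ - _ = (x - u) * (x `^ (p - 1) - u `^ (p - 1)
    - (p - 1) * x `^ (p - 2) * (x - u))); last by ring.
  by apply: mulr_ge0; lra.
have := ler_wpM2l (ltW Q0) D2; lra.
Qed.

(** Extends the uniform convexity of t^p to |t|^p.  When x and x + h have
    opposite signs, the square of |x + h| - |x| is smaller than h^2; the
    missing part is paid for by the kink, |x + h| - |x| - h = 2|x + h|. *)
Lemma norm_powR_uniform_convex x : exists A, forall h,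
  `|x| `^ p + A * h + (p - 1) ^+ 2 * (`|x| + `|h|) `^ (p - 2) * h ^+ 2
    <= `|x + h| `^ p.
Proof.
wlog x0 : x / 0 <= x.
  move=> H; have [/H//|x0] := leP 0 x.
  have [|A HA] := H (- x); first by lra.
  exists (- A) => h; have := HA (- h).
  by rewrite !normrN sqrrN mulrN -mulNr -opprD normrN.
rewrite ger0_norm //.
exists (p * x `^ (p - 1)) => h.
have [->|h0] := eqVneq h 0; first by rewrite addr0 mulr0 addr0 expr0n /= mulr0 addr0 ger0_norm.
have N0 : 0 < x + `|h| by rewrite ltr_wpDl // normr_gt0.
have P1 := p1; have P2 := p2.
have P0 : 0 < p by lra. have Q0 : 0 < p - 1 by lra.
have C0 : 0 <= (p - 1) ^+ 2 by exact: sqr_ge0.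
have [xh|xh] := leP 0 (x + h).
  have := powR_uniform_convex xh x0; rewrite (ger0_norm xh) (_ : x + h - x = h); last by ring.
  apply: le_trans; rewrite lerD2l ler_wpM2r ?sqr_ge0 // ler_wpM2l //.
  have M0 : 0 < Num.max (x + h) x.
    rewrite lt_max; have [x00|x00] := eqVneq x 0; last by rewrite [0 < x]lt0r x00 x0 orbT.
    by move: xh; rewrite x00 add0r lt_neqAle eq_sym h0 /= => ->.
  apply: powR_le_anti => //; first by lra.
  by rewrite ge_max lerD2l ler_norm /= lerDl.
have hn : h < 0 by lra.
rewrite (ltr0_norm hn) in N0 *; rewrite ltr0_norm //.
set u := - (x + h); have u0 : 0 < u by rewrite /u; lra.
have := powR_uniform_convex (ltW u0) x0; apply: le_trans.
have M0 : 0 < Num.max u x by rewrite lt_max u0.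
have MN : (x - h) `^ (p - 2) <= (Num.max u x) `^ (p - 2).
  apply: powR_le_anti => //; first lra.
  by rewrite ge_max /u; apply/andP; split; lra.
set N := (x - h) `^ (p - 2) in MN *; set M := (_ `^ (p - 2)) in MN *.
have xN : x * N <= x `^ (p - 1).
  move: x0; rewrite le_eqVlt => /predU1P[<-|x0]; first by rewrite mul0r powR_ge0.
  rewrite -(@mulr_powRB1 _ x (p - 1)) ?(ltW x0) // (_ : p - 1 - 1 = p - 2); last by ring.
  by rewrite ler_pM2l //; apply: powR_le_anti => //; lra.
have C1 : 2 * (p - 1) ^+ 2 <= p.
  by have H : (p - 1) * (2 - p) >= 0; [apply: mulr_ge0; lra|lra].
have hE : h = - (x + u) by rewrite /u; ring.
have N0' : 0 <= N by exact: powR_ge0.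
have S1 : (p - 1) ^+ 2 * N * (u - x) ^+ 2 <= (p - 1) ^+ 2 * M * (u - x) ^+ 2.
  by rewrite ler_wpM2r ?sqr_ge0 // ler_wpM2l.
have S2 : 4 * (p - 1) ^+ 2 * (x * N) * u <= 2 * p * x `^ (p - 1) * u.
  rewrite ler_wpM2r ?(ltW u0) // ler_pM //.
  - by apply: mulr_ge0; lra.
  - by apply: mulr_ge0.
  - by lra.
have S3 : (p - 1) ^+ 2 * N * h ^+ 2 = (p - 1) ^+ 2 * N * (u - x) ^+ 2
  + 4 * (p - 1) ^+ 2 * (x * N) * u by rewrite hE; ring.
have S4 : p * x `^ (p - 1) * (u - x) = p * x `^ (p - 1) * h + 2 * p * x `^ (p - 1) * u.
  by rewrite hE; ring.
lra.
Qed.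

(** A second order upper bound for t -> (r^2 + 2xt + 2t^2)^(p/2), valid for
    steps of any size: the tangent to the concave function u^(p/2) is taken at
    u = (r + |h|)^2 and not at u = r^2. *)
Lemma powR_smooth r x h : 0 <= r -> `|x| <= r ->
  (r ^+ 2 + 2 * x * h + 2 * h ^+ 2) `^ (p / 2) <=
  r `^ p + p * r `^ (p - 2) * x * h
    + 5 / 2 * p * (r + `|h|) `^ (p - 2) * h ^+ 2.
Proof.
move=> r0 xr; have P1 := p1; have P2 := p2.
have P0 : 0 < p by lra. have Q0 : 0 < p - 1 by lra.
have e1 : p - 1 - 1 = p - 2 by ring.
have [->|h0] := eqVneq h 0.
  rewrite expr0n /= !mulr0 !addr0 -powR_mulrn // -powRrM.
  by rewrite mulrCA mulfV ?mulr1.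
have H0 : 0 < `|h| by rewrite normr_gt0.
set s := r + `|h|; have s0 : 0 < s by rewrite /s; lra.
have xh : - (r * `|h|) <= x * h <= r * `|h|.
  by rewrite -ler_norml normrM ler_wpM2r.
case/andP: xh => xh1 xh2.
have R0 : 0 <= r ^+ 2 + 2 * x * h + 2 * h ^+ 2.
  have : 0 <= (r - `|h|) ^+ 2 by exact: sqr_ge0.
  have : 0 <= h ^+ 2 by exact: sqr_ge0.
  rewrite -(real_normK (num_real h)); lra.
have s20 : 0 < s ^+ 2 by rewrite exprn_gt0.
have T := @powR_concave_tangent (p / 2) _ _ (divr_gt0 P0 (ltr0n _ 2)) _ R0 s20.
have {T} := T _; rewrite ler_pdivrMr // mul1r => /(_ p2) T.
apply: le_trans T _.
have E1 : (s ^+ 2) `^ (p / 2) = s `^ p by rewrite -normr_powR gtr0_norm.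
have E2 : (s ^+ 2) `^ (p / 2 - 1) = s `^ (p - 2).
  rewrite (_ : p / 2 - 1 = (p - 2) / 2); last by field.
  by rewrite -normr_powR gtr0_norm.
rewrite E1 E2.
have CT := powR_uniform_convex r0 (ltW s0).
have Es : s `^ (p - 1) = s * s `^ (p - 2) by rewrite -e1 mulr_powRB1 // ltW.
have S0 : 0 < s `^ (p - 2) by exact: powR_gt0.
have {}CT : s `^ p - p * s `^ (p - 2) * (s * `|h|) <= r `^ p.
  apply: le_trans CT.
  rewrite (_ : r - s = - `|h|); last by rewrite /s; ring.
  rewrite Es -[leLHS]addr0; apply: lerD; last first.
    by apply: mulr_ge0; [apply: mulr_ge0; [exact: sqr_ge0|exact: powR_ge0]|exact: sqr_ge0].
  by rewrite le_eqVlt; apply/orP; left; apply/eqP; ring.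
set Y := s `^ (p - 2) in Es S0 CT *.
have S1 : x * h * Y <= r `^ (p - 2) * x * h + h ^+ 2 * Y.
  have [r00|r00] := eqVneq r 0.
    have -> : x = 0 by apply/eqP; rewrite -normr_eq0 eq_le normr_ge0 -r00 xr.
    by rewrite !(mul0r, mulr0, add0r) mulr_ge0 ?sqr_ge0 ?(ltW S0).
  have {}r0 : 0 < r by rewrite lt0r r00.
  have YX : Y <= r `^ (p - 2) by apply: powR_le_anti => //; rewrite /s; lra.
  have rX : r * r `^ (p - 2) <= s * Y.
    rewrite -Es -e1 mulr_powRB1 ?(ltW r0) //.
    by apply: ge0_ler_powR; rewrite ?nnegrE ?(ltW r0) ?(ltW s0) ?/s //; lra.
  have : - (x * h) * (r `^ (p - 2) - Y) <= `|h| * r * (r `^ (p - 2) - Y).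
    rewrite ler_wpM2r ?subr_ge0 //; lra.
  have : `|h| * (r * r `^ (p - 2)) <= `|h| * (s * Y) by rewrite ler_pM2l.
  rewrite -(real_normK (num_real h)) /s; lra.
have S2 := ler_wpM2l (ltW P0) S1.
have E3 : p / 2 * Y * (r ^+ 2 + 2 * x * h + 2 * h ^+ 2 - s ^+ 2) =
  p * (x * h * Y) - p * Y * (r * `|h|) + p / 2 * Y * h ^+ 2.
  by rewrite /s -(real_normK (num_real h)); field.
have E4 : p * Y * (s * `|h|) = p * Y * (r * `|h|) + p * Y * h ^+ 2.
  rewrite /s -(real_normK (num_real h)); ring.
rewrite E3; lra.
Qed.

(** The Bellman function with w = |x|: the second order bound on
    (x^2 + s)^(p/2) is absorbed by the uniform convexity of |x|^p. *)
Lemma square_le_sum_step x s : 0 <= s -> exists A, forall h,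
  ((x + h) ^+ 2 + (s + h ^+ 2)) `^ (p / 2) - 5 / (p - 1) ^+ 2 * `|x + h| `^ p
  <= (x ^+ 2 + s) `^ (p / 2) - 5 / (p - 1) ^+ 2 * `|x| `^ p + A * h.
Proof.
move=> s0; have P1 := p1; have P2 := p2.
have P0 : 0 < p by lra. have Q0 : 0 < p - 1 by lra.
have [A HA] := norm_powR_uniform_convex x.
pose r := Num.sqrt (x ^+ 2 + s).
have r2 : r ^+ 2 = x ^+ 2 + s by rewrite sqr_sqrtr // addr_ge0 ?sqr_ge0.
have xr : `|x| <= r by rewrite -sqrtr_sqr ler_wsqrtr // lerDl.
have r0 : 0 <= r by exact: sqrtr_ge0.
have rp : r `^ p = (x ^+ 2 + s) `^ (p / 2) by rewrite -r2 -normr_powR ger0_norm.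
exists (p * r `^ (p - 2) * x - 5 / (p - 1) ^+ 2 * A) => h.
have := powR_smooth h r0 xr; rewrite r2.
rewrite (_ : x ^+ 2 + s + 2 * x * h + 2 * h ^+ 2 = (x + h) ^+ 2 + (s + h ^+ 2)); last by ring.
rewrite rp => U.
have K0 : 0 <= 5 / (p - 1) ^+ 2 by rewrite divr_ge0 // sqr_ge0.
have := ler_wpM2l K0 (HA h).
set N := (`|x| + `|h|) `^ (p - 2).
have rN : (r + `|h|) `^ (p - 2) * h ^+ 2 <= N * h ^+ 2.
  have [->|h0] := eqVneq h 0; first by rewrite expr0n /= !mulr0.
  rewrite ler_wpM2r ?sqr_ge0 //; apply: powR_le_anti; [lra| |lra].
  by rewrite ltr_wpDl // normr_gt0.
have -> : 5 / (p - 1) ^+ 2 * (`|x| `^ p + A * h + (p - 1) ^+ 2 * N * h ^+ 2) =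
  5 / (p - 1) ^+ 2 * `|x| `^ p + 5 / (p - 1) ^+ 2 * A * h + 5 * (N * h ^+ 2).
  by field; lra.
have M0 : 0 <= N * h ^+ 2 by rewrite mulr_ge0 ?powR_ge0 ?sqr_ge0.
have : 5 / 2 * p * ((r + `|h|) `^ (p - 2) * h ^+ 2) <= 5 * (N * h ^+ 2).
  apply: (@le_trans _ _ (5 / 2 * p * (N * h ^+ 2))).
    by rewrite ler_wpM2l //; lra.
  by rewrite ler_wpM2r //; lra.
lra.
Qed.

(** The Bellman function with w = s^(1/2): here s grows by t^2, and
    concavity of s^(p/2) makes s^(p/2) grow enough to absorb the second order
    bound. *)
Lemma sum_le_square_step x s : 0 <= s -> exists A, forall h,
  ((x + h) ^+ 2 + (s + h ^+ 2)) `^ (p / 2) - 5 * (s + h ^+ 2) `^ (p / 2)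
  <= (x ^+ 2 + s) `^ (p / 2) - 5 * s `^ (p / 2) + A * h.
Proof.
move=> s0; have P1 := p1; have P2 := p2.
have P0 : 0 < p by lra. have Q0 : 0 < p - 1 by lra.
pose r := Num.sqrt (x ^+ 2 + s).
have r2 : r ^+ 2 = x ^+ 2 + s by rewrite sqr_sqrtr // addr_ge0 ?sqr_ge0.
have xr : `|x| <= r by rewrite -sqrtr_sqr ler_wsqrtr // lerDl.
have r0 : 0 <= r by exact: sqrtr_ge0.
have rp : r `^ p = (x ^+ 2 + s) `^ (p / 2) by rewrite -r2 -normr_powR ger0_norm.
exists (p * r `^ (p - 2) * x) => h.
have := powR_smooth h r0 xr; rewrite r2.
rewrite (_ : x ^+ 2 + s + 2 * x * h + 2 * h ^+ 2 = (x + h) ^+ 2 + (s + h ^+ 2)); last by ring.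
rewrite rp => U.
suff : 5 / 2 * p * (r + `|h|) `^ (p - 2) * h ^+ 2 <=
    5 * ((s + h ^+ 2) `^ (p / 2) - s `^ (p / 2)) by lra.
have [->|h0] := eqVneq h 0; first by rewrite expr0n /= addr0 subrr !mulr0.
have h20 : 0 < h ^+ 2 by rewrite exprn_even_gt0.
have sh0 : 0 < s + h ^+ 2 by lra.
have q0 : 0 < p / 2 by lra.
have q1 : p / 2 <= 1 by lra.
have := powR_concave_tangent q0 q1 s0 sh0.
suff : (r + `|h|) `^ (p - 2) * h ^+ 2 <= (s + h ^+ 2) `^ (p / 2 - 1) * h ^+ 2.
  set N := _ `^ (p - 2); set M := _ `^ (p / 2 - 1) => NM T.
  have := ler_wpM2l (ltW P0) NM; lra.
rewrite ler_wpM2r ?(ltW h20) //.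
have -> : (r + `|h|) `^ (p - 2) = ((r + `|h|) ^+ 2) `^ (p / 2 - 1).
  rewrite (_ : p / 2 - 1 = (p - 2) / 2); last by field.
  by rewrite -normr_powR (ger0_norm (addr_ge0 r0 (normr_ge0 h))).
apply: powR_le_anti => //; first lra.
rewrite sqrrD r2 (real_normK (num_real h)).
have : 0 <= r * `|h| by rewrite mulr_ge0.
have : 0 <= x ^+ 2 by exact: sqr_ge0.
lra.
Qed.

End exponent.
End power_inequalities.

(** * Martingale differences and their square functions *)

Section finite_families_of_sets.
Context {T : Type}.
Implicit Types (I K : set T) (F : set (set T)).

Lemma finite_set_extremal (le : set T -> set T -> Prop) F :
  (forall I J K, le I J -> le J K -> le I K) ->
  (forall I J, le I J -> le J I -> I = J) ->
  finite_set F -> F !=set0 ->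
  exists2 I, F I & forall K, F K -> le K I -> K = I.
Proof.
move=> le_trans le_anti finF [I0 FI0].
have [s sF] : exists s : seq (set T), forall I, F I <-> I \in s.
  exists (fset_set F) => I; rewrite in_fset_set //.
  by split=> [/mem_set|/set_mem].
suff [I sI Imin] : exists2 I, I \in s & forall K, K \in s -> le K I -> K = I.
  by exists I => [|K FK]; [exact/sF|apply: Imin; exact/sF].
have {F finF FI0 sF} : s != [::] by apply/eqP => s0; move/sF: FI0; rewrite s0.
elim: s => // J [|J' s] IH _.
  by exists J; rewrite ?mem_head // => K; rewrite inE => /eqP.
have [I sI Imin] := IH isT.
have [JI|JI] := pselect (le J I).
  exists J; rewrite ?mem_head // => K; rewrite inE => /predU1P[//|sK] KJ.
  have KI := Imin _ sK (le_trans _ _ _ KJ JI).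
  by apply: le_anti => //; rewrite KI.
exists I; first by rewrite inE sI orbT.
by move=> K; rewrite inE => /predU1P[-> //|sK]; exact: Imin.
Qed.

Lemma finite_set_minimal F : finite_set F -> F !=set0 ->
  exists2 I, F I & forall K, F K -> K `<=` I -> K = I.
Proof.
apply: (finite_set_extremal (le := fun I J => I `<=` J)) => [I J K|I J IJ JI].
  exact: subset_trans.
exact/seteqP.
Qed.

Lemma finite_set_maximal F : finite_set F -> F !=set0 ->
  exists2 I, F I & forall K, F K -> I `<=` K -> K = I.
Proof.
apply: (finite_set_extremal (le := fun I J => J `<=` I)).
  by move=> I J K JI KJ; exact: subset_trans KJ JI.
by move=> I J IJ JI; exact/seteqP.
Qed.

(** Removing an inclusion-minimal member at each step is what allows a family
    of martingale differences to be built up from coarse to fine. *)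
Lemma finite_set_minimal_ind (P : set (set T) -> Prop) :
  P set0 ->
  (forall F I, finite_set F -> F I -> (forall K, F K -> K `<=` I -> K = I) ->
     P (F `\ I) -> P F) ->
  forall F, finite_set F -> P F.
Proof.
move=> P0 PS F finF; have [n] := ubnP #|` fset_set F|.
elim: n => // n IH in F finF *; rewrite ltnS => Fn.
have [->//|F0] := eqVneq F set0.
have [I FI Imin] := finite_set_minimal finF ((set0P _).1 F0).
apply: (PS F I) => //; apply: IH; first exact: finite_setD.
have IF : I \in fset_set F by rewrite in_fset_set // inE.
by rewrite fset_setD1 // (leq_trans _ Fn) // (cardfsD1 I (fset_set F)) IF.
Qed.

End finite_families_of_sets.

Section square_function.
Context {d : measure_display} {X : measurableType d} {R : realType}.
Variable nu : {measure set X -> \bar R}.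
Implicit Types (g u v : X -> R) (D F : set (set X)) (h : set X -> X -> R).

(** The error terms of the Bellman argument; they disappear on integration. *)
Definition mean_zero g :=
  nu.-integrable [set: X] (EFin \o g) /\ (\int[nu]_x (g x)%:E = 0)%E.

Lemma mean_zero0 : mean_zero (cst 0).
Proof. by split; [exact: integrable0|rewrite integral0]. Qed.

Lemma mean_zeroD g g' : mean_zero g -> mean_zero g' ->
  mean_zero (fun x => g x + g' x).
Proof.
move=> [ig g0] [ig' g'0]; split; first exact: (integrableD measurableT ig ig').
by have := integralD_EFin measurableT ig ig'; rewrite /= => ->; rewrite g0 g'0 adde0.
Qed.

Lemma mean_zeroZ a g : mean_zero g -> mean_zero (fun x => a * g x).
Proof.
move=> [ig g0]; split; first exact: (integrableZl measurableT a ig).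
have := integralZl measurableT ig a; rewrite /= g0 mule0 => <-.
by apply: eq_integral => x _; rewrite EFinM.
Qed.

(** If the integral of v is infinite there is nothing to prove; otherwise
    k v + g is integrable, with integral k times that of v. *)
Lemma le_integral_mean_zero u v g k : 0 <= k ->
  (forall x, 0 <= u x) -> (forall x, 0 <= v x) ->
  measurable_fun setT u -> measurable_fun setT v -> mean_zero g ->
  (forall x, u x <= k * v x + g x) ->
  (\int[nu]_x (u x)%:E <= k%:E * \int[nu]_x (v x)%:E)%E.
Proof.
move=> k0 u0 v0 mu mv [ig g0] uvg.
have mEu : measurable_fun [set: X] (EFin \o u) by exact/measurable_EFinP.
have mEv : measurable_fun [set: X] (EFin \o v) by exact/measurable_EFinP.
have mEkv : measurable_fun [set: X] (EFin \o (fun x => k * v x)).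
  by apply/measurable_EFinP; exact: measurable_funM.
have kvE : (\int[nu]_x (k * v x)%:E = k%:E * \int[nu]_x (v x)%:E)%E.
  rewrite -ge0_integralZl_EFin //; last by move=> x _; rewrite lee_fin.
rewrite -kvE.
have [kvy|kvy] := eqVneq (\int[nu]_x (k * v x)%:E)%E +oo%E; first by rewrite kvy leey.
have kv0 x : 0 <= k * v x by rewrite mulr_ge0.
have ikv : nu.-integrable setT (EFin \o (fun x => k * v x)).
  apply/integrableP; split => //.
  rewrite (eq_integral (fun x => (k * v x)%:E)); last first.
    by move=> x _; rewrite gee0_abs ?lee_fin.
  by rewrite ltey.
have := integralD_EFin measurableT ikv ig; rewrite /= g0 adde0 => <-.
apply: ge0_le_integral => //.
- by move=> x _; rewrite lee_fin.
- by apply: emeasurable_funD => //; case/integrableP: ig.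
- by move=> x _ /=; rewrite -EFinD lee_fin.
Qed.

(** What the argument uses of the family of differences over the atoms: the
    index sets are nested or disjoint, and a difference is constant on every
    smaller set of the family. *)
Record martingale_differences (D : set (set X)) (h : set X -> X -> R) : Prop := {
  md_off : forall I x, D I -> ~ I x -> h I x = 0 ;
  md_nested : forall I K, D I -> D K -> I `&` K !=set0 -> I `<=` K \/ K `<=` I ;
  md_const : forall I K x y, D I -> D K -> K `<=` I -> K <> I ->
    K x -> K y -> h I x = h I y ;
  md_mean_zero : forall I, D I -> mean_zero (h I) }.

Lemma md_measurable D h I : martingale_differences D h -> D I ->
  measurable_fun setT (h I).
Proof.
by move=> md DI; have [/integrableP[/measurable_EFinP]] := md_mean_zero md DI.
Qed.

Lemma sub_martingale_differences D D' h : D' `<=` D ->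
  martingale_differences D h -> martingale_differences D' h.
Proof.
move=> D'D [off nest cst mz]; split.
- by move=> I x /D'D; exact: off.
- by move=> I K /D'D DI /D'D; exact: nest.
- by move=> I K x y /D'D DI /D'D; exact: cst.
- by move=> I /D'D; exact: mz.
Qed.

Lemma scale_martingale_differences D h (a : set X -> R) :
  martingale_differences D h -> martingale_differences D (fun I x => a I * h I x).
Proof.
move=> [off nest cst mz]; split => //.
- by move=> I x DI nIx; rewrite off // mulr0.
- by move=> I K x y DI DK KI nKI Kx Ky; rewrite (cst I K x y).
- by move=> I DI; exact: mean_zeroZ (mz _ DI).
Qed.

Definition partial_sum h F x := \sum_(I \in F) h I x.
Definition square_sum h F x := \sum_(I \in F) h I x ^+ 2.

Lemma square_sum_ge0 h F x : 0 <= square_sum h F x.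
Proof. by apply: fsumr_ge0 => I _; exact: sqr_ge0. Qed.

(** The last difference added lives on a minimal set I, on which all the
    others are constant; hence so is the slope A of the step, and A * h_I has
    integral 0. *)
Lemma bellman_induction (G : R -> R -> R) D h :
  G 0 0 <= 0 ->
  (forall x s, 0 <= s -> exists A, forall t, G (x + t) (s + t ^+ 2) <= G x s + A * t) ->
  martingale_differences D h ->
  forall F, finite_set F -> F `<=` D ->
  exists2 g, mean_zero g & forall x, G (partial_sum h F x) (square_sum h F x) <= g x.
Proof.
move=> G0 step md F finF; move: F finF; apply: finite_set_minimal_ind.
  move=> _; exists (cst 0) => [|x]; first exact: mean_zero0.
  by rewrite /partial_sum /square_sum !fsbig_set0.
move=> F I finF FI Imin IH FD.
have [|g mg Gg] := IH; first by move=> K [/FD].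
have DI := FD _ FI.
(* by minimality, the other members of the family are constant on I *)
have cstI x y K : I x -> I y -> (F `\ I) K -> h K x = h K y.
  move=> Ix Iy [FK KI].
  have DK := FD _ FK.
  have [[z [Kz Iz]]|KI0] := pselect (K `&` I !=set0).
    have [KI'|IK] := md_nested md DK DI (ex_intro _ z (conj Kz Iz)).
      by case: KI; exact: Imin.
    by apply: (md_const md DK DI IK) => // IK'; apply: KI.
  have nK z : I z -> ~ K z by move=> Iz Kz; apply: KI0; exists z.
  by rewrite !(md_off md) //; exact: nK.
have [A HA] : exists A, forall x, I x -> forall t,
    G (partial_sum h (F `\ I) x + t) (square_sum h (F `\ I) x + t ^+ 2) <=
    G (partial_sum h (F `\ I) x) (square_sum h (F `\ I) x) + A * t.
  have [[x0 Ix0]|I0] := pselect (I !=set0); last first.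
    by exists 0 => x Ix; case: I0; exists x.
  have [A HA] := step (partial_sum h (F `\ I) x0) _ (square_sum_ge0 h (F `\ I) x0).
  exists A => x Ix t.
  have -> : partial_sum h (F `\ I) x = partial_sum h (F `\ I) x0.
    by apply: eq_fsbigr => K /set_mem FK; exact: cstI.
  have -> : square_sum h (F `\ I) x = square_sum h (F `\ I) x0.
    by apply: eq_fsbigr => K /set_mem FK; rewrite (cstI x x0).
  exact: HA.
exists (fun x => g x + A * h I x).
  exact: mean_zeroD (mean_zeroZ A (md_mean_zero md DI)).
move=> x.
have -> : partial_sum h F x = partial_sum h (F `\ I) x + h I x by rewrite addrC; exact: fsbigD1.
have -> : square_sum h F x = square_sum h (F `\ I) x + h I x ^+ 2.
  by rewrite addrC; exact: (fsbigD1 I F (fun I => h I x ^+ 2)).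
have [Ix|nIx] := pselect (I x).
  by apply: (le_trans (HA x Ix _)); rewrite lerD2r.
by rewrite (md_off md) // expr0n /= mulr0 !addr0.
Qed.

Lemma measurable_partial_sum D h F : martingale_differences D h ->
  finite_set F -> F `<=` D -> measurable_fun setT (partial_sum h F).
Proof.
move=> md finF FD; rewrite /partial_sum.
under eq_fun do rewrite fsbig_finite // big_seq_fsetE.
apply: measurable_sum => -[I IF] /=; apply: (md_measurable md); apply: FD.
by move: IF; rewrite in_fset_set // inE.
Qed.

Lemma measurable_square_sum D h F : martingale_differences D h ->
  finite_set F -> F `<=` D -> measurable_fun setT (square_sum h F).
Proof.
move=> md finF FD; rewrite /square_sum.
under eq_fun do rewrite fsbig_finite // big_seq_fsetE.
apply: measurable_sum => -[I IF] /=; apply: measurable_funX.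
apply: (md_measurable md); apply: FD.
by move: IF; rewrite in_fset_set // inE.
Qed.

Section exponent.
Variable p : R.
Hypotheses (p1 : 1 < p) (p2 : p <= 2).

Definition power_integral u : \bar R := (\int[nu]_x (`|u x| `^ p)%:E)%E.
Definition square_integral h F : \bar R := (\int[nu]_x (square_sum h F x `^ (p / 2))%:E)%E.

Lemma power_integral_ge0 u : (0 <= power_integral u)%E.
Proof. by apply: integral_ge0 => x _; rewrite lee_fin powR_ge0. Qed.

Lemma square_integral_ge0 h F : (0 <= square_integral h F)%E.
Proof. by apply: integral_ge0 => x _; rewrite lee_fin powR_ge0. Qed.

Lemma measurable_norm_powR u : measurable_fun setT u ->
  measurable_fun setT (fun x => `|u x| `^ p).
Proof.
move=> mu; apply: (measurableT_comp (measurable_powR _)) => //.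
exact: measurableT_comp.
Qed.

Lemma measurable_square_sum_powR D h F q : martingale_differences D h ->
  finite_set F -> F `<=` D -> measurable_fun setT (fun x => square_sum h F x `^ q).
Proof.
move=> md finF FD; apply: (measurableT_comp (measurable_powR _)) => //.
exact: measurable_square_sum md finF FD.
Qed.

Lemma square_integral_le_power_integral D h F :
  martingale_differences D h -> finite_set F -> F `<=` D ->
  (square_integral h F <= (5 / (p - 1) ^+ 2)%:E * power_integral (partial_sum h F))%E.
Proof.
move=> md finF FD.
have P1 := p1; have P2 := p2.
set k := 5 / (p - 1) ^+ 2.
pose G x s := (x ^+ 2 + s) `^ (p / 2) - k * `|x| `^ p.
have p20 : p / 2 != 0 by rewrite gt_eqF // divr_gt0 //; lra.
have p0 : p != 0 by rewrite gt_eqF //; lra.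
have [||g mg Gg] := @bellman_induction G D h _ _ md F finF FD.
- by rewrite /G normr0 expr0n /= addr0 !powR0 // mulr0 subr0.
- by move=> x s s0; exact: square_le_sum_step.
apply: le_integral_mean_zero mg _.
- by rewrite divr_ge0 // sqr_ge0.
- by move=> x; rewrite powR_ge0.
- by move=> x; rewrite powR_ge0.
- exact: measurable_square_sum_powR md finF FD.
- exact: measurable_norm_powR (measurable_partial_sum md finF FD).
- move=> x; have := Gg x; rewrite /G.
  have : square_sum h F x `^ (p / 2) <= (partial_sum h F x ^+ 2 + square_sum h F x) `^ (p / 2).
    apply: ge0_ler_powR; rewrite ?nnegrE ?addr_ge0 ?sqr_ge0 ?square_sum_ge0 //.
    + by rewrite divr_ge0 //; lra.
    + by rewrite lerDr sqr_ge0.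
  lra.
Qed.

Lemma power_integral_le_square_integral D h F :
  martingale_differences D h -> finite_set F -> F `<=` D ->
  (power_integral (partial_sum h F) <= 5%:E * square_integral h F)%E.
Proof.
move=> md finF FD.
have P1 := p1; have P2 := p2.
pose G x s := (x ^+ 2 + s) `^ (p / 2) - 5 * s `^ (p / 2).
have p20 : p / 2 != 0 by rewrite gt_eqF // divr_gt0 //; lra.
have [||g mg Gg] := @bellman_induction G D h _ _ md F finF FD.
- by rewrite /G expr0n /= addr0 !powR0 // mulr0 subr0.
- by move=> x s s0; exact: sum_le_square_step.
apply: le_integral_mean_zero mg _ => //.
- by move=> x; rewrite powR_ge0.
- exact: measurable_norm_powR (measurable_partial_sum md finF FD).
- exact: measurable_square_sum_powR md finF FD.
- move=> x; have := Gg x; rewrite /G.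
  have : `|partial_sum h F x| `^ p <= (partial_sum h F x ^+ 2 + square_sum h F x) `^ (p / 2).
    rewrite normr_powR.
    apply: ge0_ler_powR; rewrite ?nnegrE ?addr_ge0 ?sqr_ge0 ?square_sum_ge0 //.
    + by rewrite divr_ge0 //; lra.
    + by rewrite lerDl square_sum_ge0.
  lra.
Qed.

End exponent.
End square_function.

(** * The p-th power integral *)

Section power_integrals.
Context {d : measure_display} {X : measurableType d} {R : realType}.
Variable nu : {measure set X -> \bar R}.
Variable p : R.
Hypotheses (p1 : 1 < p) (p2 : p <= 2).
Implicit Types (u v : X -> R).
Local Notation pint := (power_integral nu p).

Lemma normD_powR (a b : R) : `|a + b| `^ p <= 2 * (`|a| `^ p + `|b| `^ p).
Proof.
have P1 := p1; have P2 := p2.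
have q0 : 0 < p / 2 by lra.
have q1 : p / 2 <= 1 by lra.
rewrite !normr_powR.
have S0 : 0 <= a ^+ 2 + b ^+ 2 by rewrite addr_ge0 ?sqr_ge0.
apply: (@le_trans _ _ ((2 * (a ^+ 2 + b ^+ 2)) `^ (p / 2))).
  apply: ge0_ler_powR; rewrite ?nnegrE ?sqr_ge0 ?(ltW q0) //; first by lra.
  by have := sqr_ge0 (a - b); lra.
apply: (le_trans (powR_double q0 q1 S0)).
by rewrite ler_pM2l // powR_subadd ?sqr_ge0.
Qed.

Lemma Lfun_measurable u : u \in Lfun nu p%:E -> measurable_fun setT u.
Proof. by rewrite inE => /andP[]; rewrite inE. Qed.

Lemma Lnorm_power_integral u : ('N[nu]_(p%:E)[EFin \o u] `^ p)%E = pint u.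
Proof.
have P1 := p1.
by rewrite powR_Lnorm // gt_eqF //; lra.
Qed.

Lemma Lfun_power_integral u : u \in Lfun nu p%:E <-> measurable_fun setT u /\ (pint u < +oo)%E.
Proof.
have P1 := p1.
split=> [ul|[mu ui]].
  split; first exact: Lfun_measurable.
  move: ul; rewrite inE => /andP[_]; rewrite inE /= => /(poweR_lty p).
  by rewrite Lnorm_power_integral.
rewrite inE; apply/andP; split; rewrite inE //=.
rewrite /finite_norm; apply: (@lty_poweRy _ _ p); first by rewrite gt_eqF //; lra.
by rewrite Lnorm_power_integral.
Qed.

Lemma Lnorm_lt u (eps : R) : 0 < eps ->
  ('N[nu]_(p%:E)[EFin \o u] < eps%:E)%E = (pint u < (eps `^ p)%:E)%E.
Proof.
have P1 := p1; move=> e0.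
have P0 : 0 <= p by lra.
rewrite -Lnorm_power_integral -poweR_EFin; apply/idP/idP.
  case: ('N[nu]_(p%:E)[EFin \o u])%E (Lnorm_ge0 nu p%:E (EFin \o u)) => [r| |] //.
  rewrite lee_fin lte_fin => r0 re; rewrite !poweR_EFin lte_fin.
  by rewrite gt0_ltr_powR ?nnegrE ?(ltW e0) //; lra.
rewrite !ltNge; apply: contra => le.
apply: gt0_ler_poweR => //; rewrite in_itv /= leey andbT ?lee_fin ?(ltW e0) //.
exact: Lnorm_ge0.
Qed.

Lemma measurable_EFin_norm_powR u : measurable_fun setT u ->
  measurable_fun [set: X] (fun x => (`|u x| `^ p)%:E).
Proof. by move=> mu; apply/measurable_EFinP; exact: measurable_norm_powR. Qed.

Lemma power_integralD_le u v : measurable_fun setT u -> measurable_fun setT v ->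
  (pint (fun x => u x + v x)%R <= 2%:E * (pint u + pint v))%E.
Proof.
move=> mu mv; rewrite /power_integral -ge0_integralD //; last 2 first.
- exact: measurable_EFin_norm_powR.
- exact: measurable_EFin_norm_powR.
rewrite -ge0_integralZl_EFin //; last first.
- by apply: emeasurable_funD; exact: measurable_EFin_norm_powR.
- by move=> x _; rewrite -EFinD lee_fin addr_ge0 ?powR_ge0.
apply: ge0_le_integral => //.
- by apply: measurable_EFin_norm_powR; exact: measurable_funD.
- by apply: measurable_funeM; apply: emeasurable_funD; exact: measurable_EFin_norm_powR.
- by move=> x _; rewrite -EFinD -EFinM lee_fin; exact: normD_powR.
Qed.

Lemma power_integralN u : pint (fun x => - u x) = pint u.
Proof. by apply: eq_integral => x _; rewrite normrN. Qed.

Lemma eq_power_integral u v : u =1 v -> pint u = pint v.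
Proof. by move=> uv; apply: eq_integral => x _; rewrite uv. Qed.

(** The tangent inequalities at both points make t^p Lipschitz on bounded
    sets. *)
Lemma cvg_norm_powR (a_ : R^nat) (a : R) :
  a_ @ \oo --> a -> (fun n => `|a_ n| `^ p) @ \oo --> `|a| `^ p.
Proof.
have P1 := p1; have P2 := p2.
have lip (b c : R) : 0 <= b -> 0 <= c -> c `^ p - b `^ p <= p * c `^ (p - 1) * (c - b).
  move=> b0 c0; have := powR_uniform_convex p1 p2 b0 c0.
  have : 0 <= (p - 1) ^+ 2 * (Num.max b c) `^ (p - 2) * (b - c) ^+ 2.
    by apply: mulr_ge0; [apply: mulr_ge0; [exact: sqr_ge0|exact: powR_ge0]|exact: sqr_ge0].
  lra.
move=> /cvgrPdist_lt a_a; apply/cvgrPdist_le => e e0.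
(* eventually |a_n| <= M, so p M^(p-1) is a Lipschitz constant *)
pose M := `|a| + 1; have M0 : 0 < M by rewrite /M ltr_wpDl.
have pM0 : 0 < p * M `^ (p - 1) by rewrite mulr_gt0 ?powR_gt0 //; lra.
have mon c : 0 <= c -> c <= M -> c `^ (p - 1) <= M `^ (p - 1).
  by move=> c0 cM; apply: ge0_ler_powR; rewrite ?nnegrE ?(ltW M0) //; lra.
near=> n.
have d1 : `|a - a_ n| < 1 by near: n; exact: a_a.
have d2 : `|a - a_ n| < e / (p * M `^ (p - 1)).
  by near: n; apply: a_a; rewrite divr_gt0.
have dn : `| `|a| - `|a_ n| | <= `|a - a_ n| by exact: ler_dist_dist.
have aM : `|a| <= M by rewrite /M lerDl.
have anM : `|a_ n| <= M.
  by rewrite /M; have := le_lt_trans dn d1; rewrite ltr_norml => /andP[]; lra.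
have Lip b c : 0 <= b -> 0 <= c -> c <= M -> `|c - b| < e / (p * M `^ (p - 1)) ->
    c `^ p - b `^ p <= e.
  move=> b0 c0 cM cb; apply: (le_trans (lip _ _ b0 c0)).
  apply: (@le_trans _ _ (p * M `^ (p - 1) * `|c - b|)).
    apply: (@le_trans _ _ (p * c `^ (p - 1) * `|c - b|)).
      by rewrite ler_wpM2l ?ler_norm // mulr_ge0 ?powR_ge0 //; lra.
    by rewrite ler_wpM2r // ler_wpM2l ?mon //; lra.
  by rewrite mulrC -ler_pdivlMr // ltW.
rewrite ler_norml lerNl opprB; apply/andP; split; apply: Lip => //.
  by rewrite distrC; exact: le_lt_trans dn d2.
exact: le_lt_trans dn d2.
Unshelve. all: by end_near.
Qed.

Lemma fatou_power_integral (u_ : nat -> X -> R) u (c : \bar R) :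
  (forall n, measurable_fun setT (u_ n)) -> measurable_fun setT u ->
  {ae nu, forall x, u_ ^~ x @ \oo --> u x} ->
  (forall n, (pint (u_ n) <= c)%E) -> (pint u <= c)%E.
Proof.
move=> mu_ mu aeu u_c.
pose f n x := (`|u_ n x| `^ p)%:E.
have mf n : measurable_fun [set: X] (f n) by exact: measurable_EFin_norm_powR.
have f0 n x : [set: X] x -> (0 <= f n x)%E by move=> _; rewrite lee_fin powR_ge0.
have F := fatou nu measurableT mf f0.
apply: (@le_trans _ _ (\int[nu]_x limn_einf (f^~ x))%E); last first.
  apply: (le_trans F); rewrite limn_einf_lim.
  apply: lime_le; first exact: is_cvg_einfs.
  apply: nearW => n; apply: (le_trans _ (u_c n)).
  by apply: ereal_inf_lbound; exists n => /=.
apply: ae_ge0_le_integral => //.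
- exact: measurable_EFin_norm_powR.
- move=> x _; rewrite limn_einf_lim; apply: lime_ge; first exact: is_cvg_einfs.
  by apply: nearW => n; apply: le_ereal_inf_tmp => _ [m _ <-]; exact: f0.
- have -> : (fun x => limn_einf (f^~ x)) = (fun x => (- limn_esup (fun n => - f n x))%E) by [].
  apply: measurableT_comp => //; apply: measurable_fun_limn_esup => n.
  exact: measurableT_comp.
- apply: filterS aeu => x ux _.
  have : (f^~ x) @ \oo --> (`|u x| `^ p)%:E.
    by apply/cvg_EFin; [exact: nearW|exact: cvg_norm_powR].
  by move=> /cvg_limn_einf_sup[-> _].
Qed.

End power_integrals.

(** * Unconditional convergence and bounded square functions *)

Section unconditional_sums.
Context {d : measure_display} {X : measurableType d} {R : realType}.
Variable nu : {measure set X -> \bar R}.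
Variable p : R.
Hypotheses (p1 : 1 < p) (p2 : p <= 2).
Implicit Types (u v : X -> R) (D F : set (set X)) (h : set X -> X -> R).
Local Notation pint := (power_integral nu p).
Local Notation sqint := (square_integral nu p).
Local Notation k1 := (5 / (p - 1) ^+ 2).

Lemma square_sum_le h F F' x : finite_set F' -> F `<=` F' ->
  square_sum h F x <= square_sum h F' x.
Proof.
move=> finF' FF'; rewrite /square_sum (fsbigID F F') //= (setIidr FF') lerDl.
by apply: fsumr_ge0 => I _; exact: sqr_ge0.
Qed.

Lemma square_integral_mono D h F F' : martingale_differences nu D h ->
  finite_set F' -> F' `<=` D -> F `<=` F' -> (sqint h F <= sqint h F')%E.
Proof.
have P1 := p1; move=> md finF' F'D FF'.
have finF : finite_set F by exact: sub_finite_set finF'.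
apply: ge0_le_integral => //.
- by move=> x _; rewrite lee_fin powR_ge0.
- apply/measurable_EFinP; apply: measurable_square_sum_powR md finF _.
  exact: subset_trans F'D.
- by apply/measurable_EFinP; exact: measurable_square_sum_powR md finF' F'D.
- move=> x _; rewrite lee_fin; apply: ge0_ler_powR; rewrite ?nnegrE ?square_sum_ge0 //.
    by lra.
  exact: square_sum_le.
Qed.

(** Only the values of v on E count, since u vanishes elsewhere: this is how
    the testing condition, which integrates over J alone, is exploited. *)
Lemma power_integral_le_on E u v : measurable E ->
  measurable_fun setT u -> measurable_fun setT v -> (forall x, ~ E x -> u x = 0) ->
  (pint u <= 2%:E * (pint (fun x => u x - v x)%R + \int[nu]_(x in E) (`|v x| `^ p)%:E))%E.
Proof.
have P1 := p1; move=> mE mu mv uE.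
rewrite [in leRHS]integral_mkcond.
pose w : X -> \bar R := (fun x => (`|v x| `^ p)%:E) \_ E.
have mw : measurable_fun [set: X] w.
  by apply/measurable_restrict => //; rewrite setTI; apply: measurable_funTS;
    exact: measurable_EFin_norm_powR.
have w0 x : (0 <= w x)%E by rewrite /w patchE; case: ifP => // _; rewrite lee_fin powR_ge0.
have muv : measurable_fun [set: X] (fun x => (`|u x - v x| `^ p)%:E).
  by apply: measurable_EFin_norm_powR; exact: measurable_funB.
rewrite -/w -ge0_integralD // -ge0_integralZl_EFin //; last 2 first.
- by move=> x _; rewrite adde_ge0 // lee_fin powR_ge0.
- exact: emeasurable_funD.
apply: ge0_le_integral => //.
- exact: measurable_EFin_norm_powR.
- by apply: measurable_funeM; exact: emeasurable_funD.
- move=> x _; rewrite /w patchE; case: ifPn => [_|].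
    by rewrite -EFinD -EFinM lee_fin -[X in `|X| `^ _ <= _](subrK (v x)); exact: normD_powR.
  move/negP; rewrite inE => /uE ->.
  by rewrite normr0 powR0 ?gt_eqF ?mule_ge0 ?adde_ge0 ?lee_fin ?powR_ge0 //; lra.
Qed.

(** A finite subfamily has a smaller square function than its union with a
    large finite family, whose sum is close to s. *)
Lemma square_integral_le_uncond_sum D h s E F : martingale_differences nu D h ->
  measurable E -> (forall I x, D I -> ~ E x -> h I x = 0) ->
  uncond_sum nu p D h s -> finite_set F -> F `<=` D ->
  (sqint h F <= (2 * k1)%:E * \int[nu]_(x in E) (`|s x| `^ p)%:E)%E.
Proof.
have P1 := p1; move=> md mE hE [_ /Lfun_measurable ms hs] finF FD.
have k0 : 0 < k1 by rewrite divr_gt0 // exprn_gt0 //; lra.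
apply/lee_addgt0Pr => e e0.
have e'0 : 0 < e / (2 * k1) by rewrite divr_gt0 // mulr_gt0.
have [|F0 [finF0 F0D HF0]] := hs ((e / (2 * k1)) `^ p^-1); first exact: powR_gt0.
have finU : finite_set (F `|` F0) by rewrite finite_setU.
have UD : F `|` F0 `<=` D by rewrite subUset.
have {HF0} := HF0 _ finU (@subsetUr _ _ _) UD.
rewrite Lnorm_lt ?powR_gt0 // -powRrM mulVf ?gt_eqF ?powRr1 ?(ltW e'0) //; last by lra.
move=> small.
apply: (le_trans (square_integral_mono md finU UD (@subsetUl _ _ _))).
apply: (le_trans (square_integral_le_power_integral p1 p2 md finU UD)).
have mS := measurable_partial_sum md finU UD.
have SE x : ~ E x -> partial_sum h (F `|` F0) x = 0.
  by move=> nEx; apply: fsbig1 => I /UD DI; exact: hE.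
apply: (@le_trans _ _ (k1%:E * (2%:E * ((e / (2 * k1))%:E +
    \int[nu]_(x in E) (`|s x| `^ p)%:E)))%E).
  rewrite lee_pmul2l ?lte_fin //.
  apply: (le_trans (power_integral_le_on mE mS ms SE)).
  by rewrite lee_pmul2l // leeD2r // ltW.
have I0 : (0 <= \int[nu]_(x in E) (`|s x| `^ p)%:E)%E.
  by apply: integral_ge0 => x _; rewrite lee_fin powR_ge0.
rewrite ge0_muleDr ?lee_fin ?(ltW e'0) // ge0_muleDr ?mule_ge0 ?lee_fin ?(ltW e'0) //.
rewrite addeC muleA -!EFinM (mulrC k1 2) leeD2l // lee_fin.
rewrite le_eqVlt; apply/orP; left; apply/eqP.
by move: k0; set k := k1 => k0; field; lra.
Qed.

(** Either b is at least a fixed proportion 1/N of a + b, and then the tangent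
    at a + b shows that the increment of t^q is comparable with b^q, or b^q is
    negligible with respect to (a + b)^q. *)
Lemma powR_increment (q N a b : R) : 0 < q -> q <= 1 -> 0 < N -> 0 <= a -> 0 <= b ->
  b `^ q <= N `^ (1 - q) / q * ((a + b) `^ q - a `^ q) + N `^ (- q) * (a + b) `^ q.
Proof.
move=> q0 q1 N0 a0 b0.
have mon : a `^ q <= (a + b) `^ q.
  by apply: ge0_ler_powR; rewrite ?nnegrE ?addr_ge0 ?(ltW q0) //; lra.
have [bs|bs] := leP (N * b) (a + b).
  apply: (@le_trans _ _ (N `^ (- q) * (a + b) `^ q)); last first.
    by rewrite lerDr mulr_ge0 ?subr_ge0 // divr_ge0 ?powR_ge0 ?(ltW q0).
  rewrite powRN mulrC ler_pdivlMr ?powR_gt0 // mulrC -powRM ?(ltW N0) //.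
  by apply: ge0_ler_powR; rewrite ?nnegrE ?addr_ge0 ?mulr_ge0 ?(ltW q0) ?(ltW N0).
have bp : 0 < b by rewrite lt0r b0 andbT; apply: contraTneq bs => ->; rewrite mulr0 addr0 -leNgt.
have sp : 0 < a + b by lra.
apply: (@le_trans _ _ (N `^ (1 - q) / q * ((a + b) `^ q - a `^ q))); last first.
  by rewrite lerDl mulr_ge0 ?powR_ge0.
rewrite mulrAC ler_pdivlMr //.
have := powR_concave_tangent q0 q1 a0 sp; rewrite opprD addNKr.
have Ms : (N * b) `^ (q - 1) <= (a + b) `^ (q - 1).
  by apply: powR_le_anti => //; [lra|exact: ltW].
rewrite powRM ?(ltW N0) ?(ltW bp) // in Ms.
set s := (a + b) `^ (q - 1) in Ms * => T.
have NN : N `^ (1 - q) * N `^ (q - 1) = 1.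
  rewrite -powRD; last by rewrite (gt_eqF N0) implybT.
  by rewrite (_ : 1 - q + (q - 1) = 0) ?powRr0 //; ring.
have bE : b `^ q = b * b `^ (q - 1) by rewrite mulr_powRB1.
have : N `^ (1 - q) * (q * s * b) <= N `^ (1 - q) * ((a + b) `^ q - a `^ q).
  by rewrite ler_wpM2l ?powR_ge0 //; lra.
apply: le_trans.
have -> : b `^ q * q = N `^ (1 - q) * N `^ (q - 1) * (q * b * b `^ (q - 1)).
  by rewrite NN mul1r bE; ring.
have : N `^ (1 - q) * q * b * (N `^ (q - 1) * b `^ (q - 1)) <= N `^ (1 - q) * q * b * s.
  by rewrite ler_wpM2l // !mulr_ge0 ?powR_ge0 ?(ltW q0).
lra.
Qed.

Section bounded_square_integrals.
Variables (D : set (set X)) (h : set X -> X -> R) (M : R).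
Hypotheses (md : martingale_differences nu D h)
  (hM : forall F, finite_set F -> F `<=` D -> (sqint h F <= M%:E)%E).

Let finE F : finite_set F -> F `<=` D -> sqint h F = (fine (sqint h F))%:E.
Proof.
move=> finF FD; rewrite fineK // ge0_fin_numE ?square_integral_ge0 //.
exact: le_lt_trans (hM finF FD) (ltry _).
Qed.

Let M_ge0 : 0 <= M.
Proof.
have := hM (@finite_set0 _) (@sub0set _ D); rewrite -lee_fin; apply: le_trans.
exact: square_integral_ge0.
Qed.

Lemma square_integral_increment F0 F N : 0 < N ->
  finite_set F0 -> finite_set F -> F0 `<=` D -> F `<=` D -> F0 `&` F = set0 ->
  (sqint h F + (N `^ (1 - p / 2) / (p / 2))%:E * sqint h F0 <=
   (N `^ (1 - p / 2) / (p / 2) + N `^ (- (p / 2)))%:E * sqint h (F0 `|` F))%E.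
Proof.
have P1 := p1; have P2 := p2.
move=> N0 finF0 finF F0D FD F0F.
have finU : finite_set (F0 `|` F) by rewrite finite_setU.
have UD : F0 `|` F `<=` D by rewrite subUset.
set q := p / 2.
have q0 : 0 < q by rewrite /q; lra.
have q1 : q <= 1 by rewrite /q; lra.
set c := N `^ (1 - q) / q.
have c0 : 0 <= c by rewrite divr_ge0 ?powR_ge0 ?(ltW q0).
set n := N `^ (- q).
have n0 : 0 <= n by exact: powR_ge0.
have mF G : finite_set G -> G `<=` D ->
    measurable_fun [set: X] (fun x => (square_sum h G x `^ q)%:E).
  by move=> finG GD; apply/measurable_EFinP; exact: measurable_square_sum_powR md finG GD.
have posF G x : [set: X] x -> (0 <= (square_sum h G x `^ q)%:E)%E.
  by move=> _; rewrite lee_fin powR_ge0.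
have cn0 : 0 <= c + n by rewrite addr_ge0.
rewrite /square_integral.
rewrite -(ge0_integralZl_EFin nu measurableT (posF F0) (mF _ finF0 F0D) c0).
rewrite -(ge0_integralZl_EFin nu measurableT (posF _) (mF _ finU UD) cn0).
rewrite -(ge0_integralD nu measurableT (posF F) (mF _ finF FD)); last 2 first.
- by move=> x _; rewrite mule_ge0 ?posF // lee_fin.
- by apply: measurable_funeM; exact: mF.
apply: ge0_le_integral => //.
- by move=> x _; rewrite adde_ge0 ?mule_ge0 // lee_fin ?powR_ge0.
- by apply: emeasurable_funD; [|apply: measurable_funeM]; exact: mF.
- by apply: measurable_funeM; exact: mF.
move=> x _; rewrite -!EFinM -EFinD lee_fin.
have -> : square_sum h (F0 `|` F) x = square_sum h F0 x + square_sum h F x.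
  by rewrite /square_sum fsbigU // F0F; exact: sub0set.
have := powR_increment q0 q1 N0 (square_sum_ge0 h F0 x) (square_sum_ge0 h F x).
rewrite -/c -/n; lra.
Qed.

Lemma square_integral_disjoint F0 F N : 0 < N ->
  finite_set F0 -> finite_set F -> F0 `<=` D -> F `<=` D -> F0 `&` F = set0 ->
  fine (sqint h F) <= N `^ (1 - p / 2) / (p / 2)
     * (fine (sqint h (F0 `|` F)) - fine (sqint h F0))
     + N `^ (- (p / 2)) * fine (sqint h (F0 `|` F)).
Proof.
move=> N0 finF0 finF F0D FD F0F.
have finU : finite_set (F0 `|` F) by rewrite finite_setU.
have UD : F0 `|` F `<=` D by rewrite subUset.
have := square_integral_increment N0 finF0 finF F0D FD F0F.
rewrite (finE finF FD) (finE finF0 F0D) (finE finU UD) -!EFinM -EFinD lee_fin.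
by rewrite mulrBr addrAC -mulrDl lerBrDr.
Qed.

(** F0 is chosen so that its square integral is close to the supremum; enlarging
    it by a disjoint family can then increase the integral only a little. *)
Lemma square_integral_cauchy e : 0 < e -> exists F0, [/\ finite_set F0, F0 `<=` D &
  forall F, finite_set F -> F `<=` D -> F0 `&` F = set0 -> (sqint h F <= e%:E)%E].
Proof.
have P1 := p1; have P2 := p2; move=> e0.
pose A := [set fine (sqint h F) | F in [set F | finite_set F /\ F `<=` D]].
have leM F : finite_set F -> F `<=` D -> fine (sqint h F) <= M.
  by move=> finF FD; have := hM finF FD; rewrite finE // lee_fin.
have supA : has_sup A.
  split; first by exists (fine (sqint h set0)); exists set0 => //; split.
  by exists M => _ [F [finF FD] <-]; exact: leM.
set q := p / 2.
have q0 : 0 < q by rewrite /q; lra.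
(* N is chosen so that N^(-q) * M is at most e / 2 *)
pose N := (2 * (M + 1) / e) `^ q^-1.
have M1 : 0 < M + 1 by have := M_ge0; lra.
have N0 : 0 < N by rewrite powR_gt0 // divr_gt0 // mulr_gt0.
have Nq : N `^ (- q) = e / (2 * (M + 1)).
  rewrite powRN /N -powRrM mulVf ?gt_eqF // powRr1 ?invf_div //.
  by rewrite divr_ge0 ?(ltW e0) // mulr_ge0 // ltW.
set c := N `^ (1 - q) / q.
have c0 : 0 < c by exact: divr_gt0 (powR_gt0 _ N0) q0.
have ec : 0 < e / (2 * c) by rewrite divr_gt0 // mulr_gt0.
have [_ [F0 [finF0 F0D] <-] F0sup] := sup_adherent ec supA.
exists F0; split => // F finF FD F0F.
have finU : finite_set (F0 `|` F) by rewrite finite_setU.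
have UD : F0 `|` F `<=` D by rewrite subUset.
rewrite finE // lee_fin; apply: (le_trans (square_integral_disjoint N0 finF0 finF F0D FD F0F)).
rewrite -/q -/c Nq.
have Usup : fine (sqint h (F0 `|` F)) <= sup A.
  by apply: ub_le_sup; [case: supA|exists (F0 `|` F)].
have UM := leM _ finU UD.
rewrite [leRHS]splitr; apply: lerD.
  apply: (@le_trans _ _ (c * (e / (2 * c)))).
    by rewrite ler_pM2l // lerBlDr (le_trans Usup) // addrC -lerBlDr ltW.
  by rewrite le_eqVlt; apply/orP; left; apply/eqP; field; rewrite gt_eqF.
apply: (@le_trans _ _ (e / (2 * (M + 1)) * (M + 1))).
  apply: ler_wpM2l; first by rewrite divr_ge0 ?(ltW e0) // mulr_ge0 // ltW.
  by rewrite (le_trans UM) // lerDl.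
by rewrite le_eqVlt; apply/orP; left; apply/eqP; field; rewrite gt_eqF.
Qed.

End bounded_square_integrals.

End unconditional_sums.

Section construction_of_the_sum.
Context {d : measure_display} {X : measurableType d} {R : realType}.
Variable nu : {measure set X -> \bar R}.
Variable p : R.
Hypotheses (p1 : 1 < p) (p2 : p <= 2).
Implicit Types (u v : X -> R) (D F : set (set X)) (h : set X -> X -> R).
Local Notation pint := (power_integral nu p).
Local Notation sqint := (square_integral nu p).

(** If |a| > 2^-n then 2^n |a|^(p-1) >= 1: this is clear for |a| >= 1, and
    otherwise |a|^(p-1) >= |a| because p <= 2.  The inequality bounds a series
    of increments by a geometric series plus a weighted series of p-th
    powers. *)
Lemma norm_le_half_powR (n : nat) (a : R) :
  `|a| <= 2^-1 ^+ n + 2 ^+ n * `|a| `^ p.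
Proof.
have P1 := p1; have P2 := p2.
have t0 : 0 < 2 ^+ n :> R by rewrite exprn_gt0.
have [an|an] := leP `|a| (2^-1 ^+ n).
  by apply: (le_trans an); rewrite lerDl mulr_ge0 ?powR_ge0 ?(ltW t0).
have h0 : 0 < 2^-1 ^+ n :> R by rewrite exprn_gt0 // invr_gt0.
have a0 : 0 < `|a| by exact: lt_trans an.
apply: (@le_trans _ _ (2 ^+ n * `|a| `^ p)); last by rewrite lerDr ltW.
rewrite -(@mulr_powRB1 _ `|a| p) ?(ltW a0) //; last by lra.
rewrite mulrCA -[leLHS]mulr1 ler_pM2l //.
have [a1|a1] := leP 1 `|a|.
  rewrite -[leLHS]mulr1; apply: ler_pM => //; first by rewrite exprn_ege1 // ler1n.
  apply: (@le_trans _ _ (1 `^ (p - 1))); first by rewrite powR1.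
  by apply: ge0_ler_powR; rewrite ?nnegrE //; lra.
apply: (@le_trans _ _ (2 ^+ n * `|a|)).
  by rewrite -ler_pdivrMl // mulr1 -exprVn ltW.
rewrite ler_pM2l // -[leLHS]powRr1 ?(ltW a0) //.
by apply: ger_powR; [rewrite a0 ltW|lra].
Qed.

(** The series of the 2^n |g_(n+1) - g_n|^p has a finite integral, hence is
    finite almost everywhere; there the increments are absolutely summable.
    The limit is set to 0 elsewhere, to keep it measurable. *)
Lemma ae_cvg_of_fast_increments (g : nat -> X -> R) (c : R) :
  (forall n, measurable_fun setT (g n)) ->
  (forall n, (pint (fun x => g n.+1 x - g n x)%R <= (c * 4^-1 ^+ n)%:E)%E) ->
  exists2 s : X -> R, measurable_fun setT s &
    {ae nu, forall x, g ^~ x @ \oo --> s x}.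
Proof.
have P1 := p1; have P2 := p2.
move=> mg incr.
pose f n x := (2 ^+ n * `|g n.+1 x - g n x| `^ p)%:E.
have f0 n x : (0 <= f n x)%E by rewrite lee_fin mulr_ge0 ?powR_ge0 ?exprn_ge0.
have mpow n : measurable_fun [set: X] (fun x => (`|g n.+1 x - g n x| `^ p)%:E).
  by apply: measurable_EFin_norm_powR; exact: measurable_funB.
have mf n : measurable_fun [set: X] (f n).
  rewrite /f; under eq_fun do rewrite EFinM.
  exact: measurable_funeM.
pose S x := (\sum_(0 <= n <oo) f n x)%E.
have mS : measurable_fun [set: X] S by exact: ge0_emeasurable_sum.
have S0 x : (0 <= S x)%E by exact: nneseries_ge0.
have Sfin : (\int[nu]_x S x < +oo)%E.
  rewrite integral_nneseries //.
  have c0 : 0 <= c.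
    have := le_trans (power_integral_ge0 _ _ _) (incr 0%N).
    by rewrite lee_fin expr0 mulr1.
  apply: (@le_lt_trans _ _ (\sum_(0 <= n <oo) (2 * c / (2 ^ (n + 1))%:R)%:E)%E); last first.
    have H := @cvg_geometric_eseries_half R (2 * c) 0.
    by rewrite (cvg_lim _ H) ?ltry.
  apply: lee_nneseries => n _; first by move=> _; apply: integral_ge0.
  rewrite /f; under eq_integral do rewrite EFinM.
  rewrite ge0_integralZl_EFin ?exprn_ge0 //.
  apply: (@le_trans _ _ ((2 ^+ n)%:E * (c * 4^-1 ^+ n)%:E)%E).
    by rewrite lee_pmul2l ?lte_fin ?exprn_gt0 //; exact: incr.
  have t0 : 2 ^+ n != 0 :> R by rewrite expf_neq0.
  have -> : 2 * c / (2 ^ (n + 1))%:R = c * (2 ^+ n)^-1.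
    by rewrite natrX exprD expr1; field.
  rewrite -EFinM lee_fin mulrCA ler_wpM2l //.
  rewrite (_ : 4 = 2 * 2 :> R); last by rewrite -natrM.
  by rewrite invfM exprMn mulrA -exprMn mulfV // expr1n mul1r exprVn.
have aefin : {ae nu, forall x, S x \is a fin_num}.
  have iS : nu.-integrable setT S.
    apply/integrableP; split => //.
    by under eq_integral do rewrite gee0_abs //.
  by apply: filterS (integrable_ae measurableT iS) => x; exact.
pose E := S @^-1` [set y | (y < +oo)%E].
have mE : measurable E.
  rewrite -[E]setTI; apply: measurable_lte => //.
have cvgE x : E x -> cvgn (g ^~ x).
  move=> Ex.
  have cS : cvgn (series (fun n => 2 ^+ n * `|g n.+1 x - g n x| `^ p)).
    by apply: nnseries_is_cvg => // n; rewrite mulr_ge0 ?powR_ge0 ?exprn_ge0.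
  have cH : cvgn (series (geometric 1 (2^-1 : R))).
    apply/cvg_ex; exists (1 / (1 - 2^-1)); apply: cvg_geometric_series.
    by rewrite ger0_norm ?invf_lt1 ?ltr1n ?invr_ge0.
  have cT : cvgn (series (telescope (g ^~ x))).
    apply: normed_cvg.
    apply: (@series_le_cvg _ _ (fun n => 2^-1 ^+ n + 2 ^+ n * `|g n.+1 x - g n x| `^ p)).
    - by move=> n; exact: normr_ge0.
    - by move=> n; rewrite addr_ge0 ?exprn_ge0 ?invr_ge0 // mulr_ge0 ?powR_ge0 ?exprn_ge0.
    - by move=> n; exact: norm_le_half_powR.
    - rewrite (_ : (fun n => _) = geometric 1 2^-1 +
          (fun n => 2 ^+ n * `|g n.+1 x - g n x| `^ p)); last first.
        by apply/funext => n; rewrite fctE /geometric /= mul1r.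
      by rewrite seriesD; exact: is_cvgD.
  rewrite telescopeK in cT.
  have -> : g ^~ x = [sequence g n x - g 0%N x]_n + cst (g 0%N x).
    by apply/funext => n; rewrite fctE /= subrK.
  by apply: is_cvgD => //; exact: is_cvg_cst.
pose s x := limn (fun n => g n x * \1_E x).
have cvgs x : (fun n => g n x * \1_E x) @ \oo --> s x.
  suff : cvgn (fun n => g n x * \1_E x) by [].
  have [Ex|nEx] := pselect (E x).
    by apply: is_cvgMl; exact: cvgE.
  rewrite indicE memNset //; under eq_fun do rewrite mulr0.
  exact: is_cvg_cst.
exists s.
  apply: (@measurable_fun_cvg _ _ _ _ (fun n x => g n x * \1_E x)) => // n.
  by apply: measurable_funM => //; exact: measurable_indic.
apply: filterS aefin => x Sx.
have Ex : E x by move: Sx; rewrite ge0_fin_numE.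
have := cvgs x; rewrite indicE mem_set //.
by under eq_fun do rewrite mulr1.
Qed.

Lemma partial_sum_split h F F' x : finite_set F -> finite_set F' ->
  partial_sum h F x - partial_sum h F' x =
  partial_sum h (F `\` F') x - partial_sum h (F' `\` F) x.
Proof.
move=> finF finF'; rewrite /partial_sum.
rewrite (fsbigID F' F) // [X in _ - X](fsbigID F F') //= (setIC F' F).
by rewrite -!setDE opprD addrACA subrr add0r.
Qed.

#[local] Opaque square_integral power_integral.

Lemma power_integral_diff_le D h F0 e : martingale_differences nu D h ->
  (forall F, finite_set F -> F `<=` D -> F0 `&` F = set0 -> (sqint h F <= e%:E)%E) ->
  forall F F', finite_set F -> F `<=` D -> finite_set F' -> F' `<=` D ->
  F0 `<=` F -> F0 `<=` F' ->
  (pint (fun x => partial_sum h F x - partial_sum h F' x)%R <= (20 * e)%:E)%E.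
Proof.
move=> md tail F F' finF FD finF' F'D F0F F0F'.
have aux G G' : finite_set G -> G `<=` D -> F0 `<=` G' ->
    measurable_fun setT (partial_sum h (G `\` G')) /\
    (pint (partial_sum h (G `\` G')) <= (5 * e)%:E)%E.
  move=> finG GD F0G'.
  have finGG' : finite_set (G `\` G') by exact: finite_setD.
  have GG'D : G `\` G' `<=` D by move=> I [/GD].
  split; first exact: measurable_partial_sum md finGG' GG'D.
  apply: (le_trans (power_integral_le_square_integral p1 p2 md finGG' GG'D)).
  rewrite EFinM lee_pmul2l ?lte_fin //; apply: tail => //.
  by apply/seteqP; split => // I [/F0G'] G'I [].
rewrite (eq_power_integral _ _ (v := fun x => partial_sum h (F `\` F') x + - partial_sum h (F' `\` F) x)); last first.
  by move=> x; exact: partial_sum_split.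
have [m1 b1] := aux F F' finF FD F0F'.
have [m2 b2] := aux F' F finF' F'D F0F.
apply: (le_trans (power_integralD_le nu p1 p2 m1 _)); first exact: measurableT_comp.
rewrite power_integralN (_ : 20 * e = 2 * (5 * e + 5 * e)); last by ring.
by rewrite EFinM EFinD; apply: lee_wpmul2l; [rewrite lee_fin|exact: leeD b1 b2].
Qed.

(** The sum is constructed along finite sets F n whose tails decay
    geometrically, and Fatou's lemma transfers the estimates to the limit. *)
Theorem uncond_sum_of_square_integral D h M : martingale_differences nu D h ->
  (forall F, finite_set F -> F `<=` D -> (sqint h F <= M%:E)%E) ->
  exists2 s, uncond_sum nu p D h s & (pint s <= (5 * M)%:E)%E.
Proof.
have P1 := p1; have P2 := p2; move=> md hM.
have e0 n : 0 < 4^-1 ^+ n :> R by rewrite exprn_gt0 // invr_gt0.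
have /choice[F0 HF0] n := square_integral_cauchy p1 p2 md hM (e0 n).
pose F n := \bigcup_(k in `I_n.+1) F0 k.
have finF n : finite_set (F n).
  by apply: bigcup_finite => // k _; have [] := HF0 k.
have FD n : F n `<=` D by move=> I [k _]; have [_ + _] := HF0 k; exact.
have F0F n m : (n <= m)%N -> F0 n `<=` F m by move=> nm I F0I; exists n.
pose g n := partial_sum h (F n).
have mg n : measurable_fun setT (g n) by exact: measurable_partial_sum md (finF n) (FD n).
have close n G G' : finite_set G -> G `<=` D -> finite_set G' -> G' `<=` D ->
    F0 n `<=` G -> F0 n `<=` G' ->
    (pint (fun x => partial_sum h G x - partial_sum h G' x)%R <= (20 * 4^-1 ^+ n)%:E)%E.
  by have [_ _ tail] := HF0 n; exact: power_integral_diff_le.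
have [s ms gs] : exists2 s : X -> R, measurable_fun setT s &
    {ae nu, forall x, g ^~ x @ \oo --> s x}.
  apply: (ae_cvg_of_fast_increments mg) => n.
  by apply: close => //; exact: F0F.
have ints : (pint s <= (5 * M)%:E)%E.
  apply: (fatou_power_integral p1 p2 mg ms gs) => n.
  apply: (le_trans (power_integral_le_square_integral p1 p2 md (finF n) (FD n))).
  by rewrite EFinM lee_pmul2l ?lte_fin //; exact: hM.
exists s => //; split.
- move=> I DI; apply/(Lfun_power_integral nu p1); split; first exact: md_measurable md DI.
  have ID : [set I] `<=` D by move=> _ ->.
  rewrite -(eq_power_integral _ _ (u := partial_sum h [set I])); last first.
    by move=> x; rewrite /partial_sum fsbig_set1.
  apply: (le_lt_trans (power_integral_le_square_integral p1 p2 md (finite_set1 I) ID)).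
  apply: (@le_lt_trans _ _ (5 * M)%:E); last by rewrite ltry.
  by rewrite EFinM lee_pmul2l ?lte_fin //; exact: hM.
- by apply/(Lfun_power_integral nu p1); split => //; apply: (le_lt_trans ints); rewrite ltry.
move=> eps eps0.
have ep0 : 0 < eps `^ p by exact: powR_gt0.
have [n small] : exists n, 20 * 4^-1 ^+ n < eps `^ p.
  have : geometric 20 (4^-1 : R) @ \oo --> 0.
    by apply: cvg_geometric; rewrite ger0_norm ?invf_lt1 ?ltr1n ?invr_ge0.
  move=> /cvgrPdist_lt /(_ _ ep0) [n _ /(_ n (leqnn n))] /=.
  rewrite sub0r normrN ger0_norm ?mulr_ge0 ?exprn_ge0 ?invr_ge0 // => H.
  by exists n.
exists (F n); split => // G finG FG GD.
rewrite Lnorm_lt //; apply: (@le_lt_trans _ _ (20 * 4^-1 ^+ n)%:E); last by rewrite lte_fin.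
have mG := measurable_partial_sum md finG GD.
apply: (@fatou_power_integral _ _ _ nu p p1 p2 (fun m x => partial_sum h G x - g (m + n)%N x)).
- by move=> m; exact: measurable_funB.
- exact: measurable_funB.
- apply: filterS gs => x gx; apply: cvgB; first exact: cvg_cst.
  by move: gx; rewrite -(cvg_shiftn n).
- move=> m; apply: close => //; last by apply: F0F; exact: leq_addl.
  by apply: subset_trans FG; exact: F0F.
Qed.

End construction_of_the_sum.

(** * Averages over a countable partition *)

Section averaging.
Context {d : measure_display} {X : measurableType d} {R : realType}.
Variable nu : {measure set X -> \bar R}.

(** A countable family is indexed by all of nat, padding with empty sets: this
    covers finite families too. *)
Lemma countable_trivIset_seq (C : set (set X)) : countable C -> trivIset C id ->
  exists F : nat -> set X, [/\ trivIset setT F, forall k, F k = set0 \/ C (F k) &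
    forall A, C A -> exists k, F k = A].
Proof.
move=> /countable_injP[f injf] tC.
pose F k := \bigcup_(A in [set A | C A /\ f A = k]) A.
have FE A : C A -> F (f A) = A.
  move=> CA; apply/seteqP; split=> [x [B [CB fBA] Bx]|x Ax]; last by exists A.
  by rewrite -(injf B A) ?inE.
have Fcase k : F k = set0 \/ exists2 A, C A & k = f A.
  have [[A CA ->]|noA] := pselect (exists2 A, C A & k = f A); first by right; exists A.
  left; rewrite -subset0 => x [A [CA fA] _]; apply: noA.
  by exists A.
exists F; split.
- move=> i j _ _ [x [Fix Fjx]].
  have [F0|[A CA iA]] := Fcase i; first by rewrite F0 in Fix.
  have [F0|[B CB jB]] := Fcase j; first by rewrite F0 in Fjx.
  rewrite iA jB !FE // in Fix Fjx *.
  by congr f; apply: tC => //; exists x.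
- by move=> k; have [->|[A CA ->]] := Fcase k; [left|right; rewrite FE].
- by move=> A CA; exists (f A); exact: FE.
Qed.

Variables (F : nat -> set X) (g : X -> R).
Hypotheses (tF : trivIset setT F) (mF : forall k, measurable (F k)).
Hypothesis (g0 : forall x, (forall k, ~ F k x) -> g x = 0).

Lemma measurable_piecewise_constant :
  (forall k x y, F k x -> F k y -> g x = g y) -> measurable_fun setT g.
Proof.
move=> gcst _ Y mY; rewrite setTI.
have mU : measurable (\bigcup_k F k) by exact: bigcup_measurable.
rewrite (_ : g @^-1` Y = \bigcup_(k in [set k | F k `<=` g @^-1` Y]) F k `|`
    (~` (\bigcup_k F k) `&` [set _ | Y 0])); last first.
  apply/seteqP; split=> [x Yx|x [[k FY /FY//]|[nUx Y0]]].
    have [[k _ Fkx]|nUx] := pselect ((\bigcup_k F k) x).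
      left; exists k => //= y Fky; rewrite /= (gcst k y x) //.
    right; split => //=; rewrite -(g0 (x := x)) // => k Fkx.
    by apply: nUx; exists k.
  by rewrite /= g0 // => k Fkx; apply: nUx; exists k.
apply: measurableU; first exact: bigcup_measurable.
apply: measurableI; first exact: measurableC.
have [Y0|Y0] := pselect (Y 0).
  by rewrite (_ : [set _ | _] = setT) //; apply/seteqP; split.
by rewrite (_ : [set _ | _] = set0) //; apply/seteqP; split.
Qed.

Variable w : X -> R.
Hypotheses (nuF : forall k, (nu (F k) < +oo)%E)
  (iw : nu.-integrable (\bigcup_k F k) (EFin \o w))
  (gcst : forall k x y, F k x -> F k y -> g x = g y)
  (gE : forall k x, nu (F k) != 0%E -> F k x -> g x = average nu w (F k)).

Let iwF k : nu.-integrable (F k) (EFin \o w).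
Proof.
apply: integrableS iw => //; first exact: bigcup_measurable.
by move=> x Fx; exists k.
Qed.

Let intFk k : (\int[nu]_(x in F k) (g x)%:E = \int[nu]_(x in F k) (w x)%:E)%E /\
  (\int[nu]_(x in F k) `|(g x)%:E| <= \int[nu]_(x in F k) `|(w x)%:E|)%E.
Proof.
have fink : nu (F k) \is a fin_num by rewrite ge0_fin_numE.
have finw := integrable_fin_num (mF k) (iwF k).
have mw : measurable_fun (F k) (EFin \o w) by case/integrableP: (iwF k).
have [nu0|nu0] := eqVneq (nu (F k)) 0%E.
  have mg : measurable_fun (F k) (EFin \o g).
    by apply/measurable_EFinP; apply: measurable_funTS; exact: measurable_piecewise_constant.
  split; first by rewrite (null_set_integral (mF k) mg nu0) (null_set_integral (mF k) mw nu0).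
  by rewrite null_set_integral //; [exact: integral_ge0|exact: measurableT_comp mg].
have intw : (average nu w (F k) * fine (nu (F k)))%:E = (\int[nu]_(x in F k) (w x)%:E)%E.
  rewrite /average mulrAC mulVf ?mul1r; last first.
    by rewrite fine_eq0.
  by rewrite /Rintegral fineK.
split.
  rewrite (eq_integral (cst (average nu w (F k))%:E)); last first.
    by move=> x /set_mem Fx; rewrite (gE nu0 Fx).
  by rewrite integral_cst // -intw [RHS]EFinM fineK.
have -> : (\int[nu]_(x in F k) `|(g x)%:E| =
    \int[nu]_(x in F k) (cst `|average nu w (F k)|%:E x))%E.
  by apply: eq_integral => x /set_mem Fx; rewrite (gE nu0 Fx).
rewrite integral_cst //.
have <- : `|(average nu w (F k) * fine (nu (F k)))%:E|%E = (`|average nu w (F k)|%:E * nu (F k))%E.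
  by rewrite /= normrM (ger0_norm (fine_ge0 _)) // EFinM fineK.
by rewrite intw; exact: le_abse_integral.
Qed.

(** Averaging preserves the integral of w over each piece and does not increase
    that of its absolute value.  On a null piece g may be any constant: there
    [average] is 0 by convention, which need not be the value of g. *)
Lemma integral_averaging : nu.-integrable [set: X] (EFin \o g) /\
  (\int[nu]_x (g x)%:E = \int[nu]_(x in \bigcup_k F k) (w x)%:E)%E.
Proof.
have mU : measurable (\bigcup_k F k) by exact: bigcup_measurable.
have mg : measurable_fun [set: X] (EFin \o g).
  by apply/measurable_EFinP; exact: measurable_piecewise_constant.
have mgU : measurable_fun (\bigcup_k F k) (EFin \o g) by exact: measurable_funTS.
have gU : (EFin \o g) \_ (\bigcup_k F k) = EFin \o g.
  apply/funext => x; rewrite patchE; case: ifPn => // /negP; rewrite inE => nUx /=.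
  by rewrite g0 // => k Fkx; apply: nUx; exists k.
have igU : nu.-integrable (\bigcup_k F k) (EFin \o g).
  apply/integrableP; split => //.
  case/integrableP: (iw) => mw; apply: le_lt_trans.
  have mw' : measurable_fun (\bigcup_k F k) (fun x => `|(w x)%:E|%E).
    exact: measurableT_comp mw.
  have mg' : measurable_fun (\bigcup_k F k) (fun x => `|(g x)%:E|%E).
    exact: measurableT_comp mgU.
  rewrite !ge0_integral_bigcup //.
  by apply: lee_nneseries => k _; [move=> _; exact: integral_ge0|have [] := intFk k].
split.
  by rewrite -gU; apply/(integrable_mkcond _ mU).
transitivity (\int[nu]_(x in \bigcup_k F k) (g x)%:E)%E.
  by rewrite [RHS]integral_mkcond; congr (integral _ _ _); rewrite -[LHS]gU.
have := integral_bigcup tF mF igU; have := integral_bigcup tF mF iw.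
rewrite /= => -> ->.
by apply: eq_eseriesr => k _; have [] := intFk k.
Qed.

End averaging.

(** * Atoms of a filtration and their children *)

Lemma int_set_max_or_unbounded (A : set int) : A !=set0 ->
  (exists2 n, A n & forall k, A k -> k <= n) \/ (forall m, exists2 n, A n & m <= n).
Proof.
move=> [a Aa]; have [|nomax] := pselect (exists2 n, A n & forall k, A k -> k <= n).
  by left.
right.
have next n : A n -> exists2 k, A k & n < k.
  move=> An; apply: contrapT => no; apply: nomax; exists n => // k Ak.
  by rewrite leNgt; apply/negP => nk; apply: no; exists k.
have far (j : nat) : exists2 n, A n & a + j%:Z <= n.
  elim: j => [|j [n An jn]]; first by exists a => //; rewrite addr0.
  by have [k Ak nk] := next _ An; exists k => //; lia.
move=> m; have [n An mn] := far `|m - a|%N.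
by exists n => //; lia.
Qed.

Section atoms_of_a_filtration.
Context {d : measure_display} {X : measurableType d}.
Variables (S L : int -> set (set X)).
Hypothesis af : atomic_filtration S L.
Implicit Types (I K J : set X) (n m : int).

Lemma atom_cover n x : exists2 I, L n I & I x.
Proof.
have [[S0 SD _] _ _ _ _ _ Sun] := af_atomic af n.
have [L' L'L TE] := Sun _ (SD _ S0).
have : (setT `\` set0) x by split.
by rewrite TE => -[I L'I Ix]; exists I => //; exact: L'L.
Qed.

Lemma sigma_mono n m : n <= m -> S n `<=` S m.
Proof.
move=> nm; rewrite (_ : m = n + `|m - n|%N%:Z); last by lia.
elim: `|m - n|%N => [|j IH]; first by rewrite addr0.
apply: (subset_trans IH); rewrite -addn1 PoszD addrA.
exact: (af_incr af).
Qed.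

(** A belongs to the finer sigma-algebra as well, so it is a union of finer
    atoms, one of which is K. *)
Lemma atom_sub n m A K : n <= m -> S n A -> L m K -> K `&` A !=set0 -> K `<=` A.
Proof.
move=> nm SA LK [x [Kx Ax]].
have [_ _ _ tL _ _ Sun] := af_atomic af m.
have [L' L'L AE] := Sun _ (sigma_mono nm SA).
move: (Ax); rewrite AE => -[I L'I Ix].
have -> : K = I by apply: tL => //; [exact: L'L|exists x].
by move=> y Iy; exists I.
Qed.

Lemma atom_sigma n I : L n I -> S n I.
Proof. exact: (asa_atoms (af_atomic af n)). Qed.

Lemma atom_neq0 I : atoms L I -> I !=set0.
Proof. by case=> n _ LI; exact: (asa_nonempty (af_atomic af n) LI). Qed.

Lemma atom_measurable I : atoms L I -> measurable I.
Proof. by case=> n _ LI; apply: (asa_sub (af_atomic af n)); exact: atom_sigma. Qed.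

Lemma atom_nested n m I K : n <= m -> L n I -> L m K -> K `&` I !=set0 -> K `<=` I.
Proof. by move=> nm /atom_sigma; exact: atom_sub. Qed.

Lemma atoms_nested I K : atoms L I -> atoms L K -> I `&` K !=set0 ->
  I `<=` K \/ K `<=` I.
Proof.
move=> [n _ LI] [m _ LK] IK; have [nm|mn] := leP n m.
  by right; apply: (atom_nested nm LI LK); rewrite setIC.
by left; exact: (atom_nested (ltW mn) LK LI).
Qed.

Context {R : realType}.

(** The rank is a supremum of integers: it is either attained or infinite. *)
Lemma children_cases I : atoms L I ->
  (exists2 n, L n I & children (R := R) L I = [set I' | L (n + 1) I' /\ I' `<=` I]) \/
  ((forall m, exists2 n, L n I & m <= n) /\ children (R := R) L I = [set I]).
Proof.
move=> [n0 _ LI0].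
have [[n LI nmax]|unb] := int_set_max_or_unbounded (ex_intro [set n | L n I] n0 LI0).
  left; exists n => //.
  have rkE : rk (R := R) L I = (n%:~R)%:E.
    apply/le_anti/andP; split; last by apply: ereal_sup_ubound; exists n.
    by apply: ge_ereal_sup => _ [k Lk <-]; rewrite lee_fin ler_int; exact: nmax.
  apply/seteqP; split=> I'.
    move=> [[]|[k []]]; first by rewrite rkE.
    by rewrite rkE => -[/eqP]; rewrite eqr_int => /eqP ->.
  by move=> [LI' I'I]; right; exists n.
right; split => //.
have rkE : rk (R := R) L I = +oo%E.
  apply: eq_infty => r; have [n Ln rn] := unb (Num.ceil r).
  apply: (@le_trans _ _ (n%:~R)%:E); last by apply: ereal_sup_ubound; exists n.
  by rewrite lee_fin (le_trans (ceil_ge r)) // ler_int.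
apply/seteqP; split=> I'; first by move=> [[_ ->]|[k []]] //; rewrite rkE.
by move=> ->; left.
Qed.

Section one_atom.
Variable I : set X.
Hypothesis atI : atoms L I.
Local Notation children := (children (R := R)).

Lemma child_sub I' : children L I I' -> I' `<=` I.
Proof. by have [[n _ ->]|[_ ->]] := children_cases atI; [case|move=> ->]. Qed.

Lemma child_atom I' : children L I I' -> atoms L I'.
Proof.
by have [[n _ ->]|[_ ->]] := children_cases atI; [move=> [LI' _]; exists (n + 1)|move=> ->].
Qed.

Lemma children_countable : countable (children L I).
Proof.
have [[n _ ->]|[_ ->]] := children_cases atI; last exact: countable1.
apply: (@sub_countable _ _ _ (L (n + 1))).
  by apply: subset_card_le => I' [].
exact: (asa_countable (af_atomic af (n + 1))).
Qed.

Lemma children_trivIset : trivIset (children L I) id.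
Proof.
have [[n _ ->]|[_ ->]] := children_cases atI; last exact: trivIset1.
move=> A B [LA _] [LB _]; exact: (asa_disjoint (af_atomic af (n + 1))).
Qed.

Lemma children_cover x : I x -> exists2 I', children L I I' & I' x.
Proof.
have [[n LI ->]|[_ ->]] := children_cases atI; last by exists I.
move=> Ix; have [I' LI' I'x] := atom_cover (n + 1) x.
exists I' => //; split => //.
have nn1 : n <= n + 1 by lia.
by apply: (atom_nested nn1 LI LI'); exists x.
Qed.

(** An atom strictly inside I is strictly later than every occurrence of I.
    Hence I has finite rank n, and the smaller atom occurs at level n + 1 or
    later. *)
Lemma proper_atom_in_child K : atoms L K -> K `<=` I -> K <> I ->
  exists2 I', children L I I' & K `<=` I'.
Proof.
move=> [m _ LK] KI nKI.
have [x Kx] := atom_neq0 (ex_intro2 _ _ m Logic.I LK).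
have later n : L n I -> n < m.
  move=> LI; rewrite ltNge; apply/negP => mn; apply: nKI.
  apply/seteqP; split => //; apply: (atom_nested mn LK LI).
  by exists x; split => //; exact: KI.
have [[n LI ->]|[unb _]] := children_cases atI; last first.
  by have [n /later nm mn] := unb m; lia.
have [I' LI' I'x] := atom_cover (n + 1) x.
exists I'.
  have nn1 : n <= n + 1 by lia.
  by split => //; apply: (atom_nested nn1 LI LI'); exists x; split => //; exact: KI.
have n1m : n + 1 <= m by have := later _ LI; lia.
by apply: (atom_nested n1m LI' LK); exists x.
Qed.

Lemma mdiff_off (sigma : {measure set X -> \bar R}) f x : ~ I x -> mdiff L sigma f I x = 0.
Proof.
move=> nIx; rewrite /mdiff /expect indicE memNset // mulr0 subr0.
apply: fsbig1 => I' ch; rewrite indicE memNset ?mulr0 // => I'x.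
by apply: nIx; exact: child_sub ch _ I'x.
Qed.

Lemma mdiff_on_child (sigma : {measure set X -> \bar R}) f I' x : children L I I' -> I' x ->
  mdiff L sigma f I x = average sigma f I' - average sigma f I.
Proof.
move=> ch I'x; rewrite /mdiff; congr (_ - _); last first.
  by rewrite /expect indicE mem_set ?mulr1 //; exact: child_sub ch _ I'x.
rewrite -(fsbig_widen [set I']).
- by rewrite fsbig_set1 /expect indicE mem_set ?mulr1.
- by move=> _ ->.
- move=> K [chK KI']; rewrite /= /expect indicE memNset ?mulr0 // => Kx.
  by apply: KI'; apply: children_trivIset => //; exists x.
Qed.

(** On the children of I, up to null ones, the difference is the average of
    f minus its average over I, and this function has integral 0 over I. *)
Lemma mdiff_mean_zero (sigma : {measure set X -> \bar R}) f :
  locally_finite L sigma -> sigma.-integrable I (EFin \o f) ->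
  mean_zero sigma (mdiff L sigma f I).
Proof.
move=> lf inf.
have sI : (sigma I < +oo)%E by exact: lf.
have [F [tF Fch chF]] := countable_trivIset_seq children_countable children_trivIset.
have UF : \bigcup_k F k = I.
  apply/seteqP; split=> [x [k _ Fx]|x Ix].
    by have [F0|ch] := Fch k; [rewrite F0 in Fx|exact: child_sub ch _ Fx].
  have [I' /chF[k <-] Fx] := children_cover Ix.
  by exists k.
have mF k : measurable (F k).
  by have [->|ch] := Fch k => //; exact/atom_measurable/child_atom.
have sF k : (sigma (F k) < +oo)%E.
  by have [->|ch] := Fch k; [rewrite measure0|exact/lf/child_atom].
have mI := atom_measurable atI.
set a := average sigma f I.
have icst : sigma.-integrable I (EFin \o cst a) 
  by apply: measurable_bounded_integrable => //; exists `|a|; split => // y ay x _; exact: ltW.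
pose w x := f x - a.
have iw : sigma.-integrable I (EFin \o w) by exact: (integrableB mI inf icst).
have gcst k x y : F k x -> F k y -> mdiff L sigma f I x = mdiff L sigma f I y.
  have [->//|ch] := Fch k.
  by move=> Fx Fy; rewrite (mdiff_on_child sigma f ch Fx) (mdiff_on_child sigma f ch Fy).
have gE k x : sigma (F k) != 0%E -> F k x -> mdiff L sigma f I x = average sigma w (F k).
  move=> sF0 Fx; have [F0|ch] := Fch k; first by rewrite F0 in Fx.
  rewrite (mdiff_on_child sigma f ch Fx) -/a /average.
  have FI : F k `<=` I by exact: child_sub.
  rewrite RintegralB //; last 2 first.
  - exact: integrableS mI (mF k) FI inf.
  - exact: integrableS mI (mF k) FI icst.
  rewrite Rintegral_cst // mulrBr [X in _ = _ - X]mulrCA mulVf ?mulr1 //.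
  by rewrite fine_eq0 // ge0_fin_numE.
have goff x : (forall k, ~ F k x) -> mdiff L sigma f I x = 0.
  by move=> nFx; apply: mdiff_off => Ix; move: Ix; rewrite -UF => -[k _]; exact: nFx.
have [|im mint] := @integral_averaging _ _ _ sigma F (mdiff L sigma f I) tF mF goff w sF _ gcst gE.
  by rewrite UF.
split => //; rewrite mint UF.
rewrite -(fineK (integrable_fin_num mI iw)); congr EFin.
rewrite -[LHS]/(\int[sigma]_(x in I) w x) RintegralB // Rintegral_cst // /a /average.
have [s0|s0] := eqVneq (fine (sigma I)) 0.
  have s0' : sigma I = 0%E by rewrite -(fineK (_ : sigma I \is a fin_num)) ?s0 // ge0_fin_numE.
  rewrite s0 mulr0 subr0 /Rintegral null_set_integral //.
  by case/integrableP: inf.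
by rewrite mulrAC mulVf // mul1r subrr.
Qed.

End one_atom.
End atoms_of_a_filtration.

(** * A Carleson embedding for the square function *)

Lemma finite_set_argmax (T : Type) (R : realDomainType) (v : set T -> R) (F : set (set T)) :
  finite_set F -> F !=set0 -> exists2 I0, F I0 & forall I, F I -> v I <= v I0.
Proof.
move: F; apply: finite_set_minimal_ind; first by case.
move=> F I _ FI _ IH _.
have [[J FJ]|noJ] := pselect (F `\ I !=set0); last first.
  exists I => // J FJ; have [->//|JI] := pselect (J = I).
  by case: noJ; exists J.
have [I0 [FI0 _] I0max] := IH (ex_intro _ J FJ).
have [le|lt] := leP (v I) (v I0).
  exists I0 => // K FK; have [->//|KI] := pselect (K = I).
  exact: I0max.
exists I => // K FK; have [->//|KI] := pselect (K = I).
by apply: (le_trans _ (ltW lt)); exact: I0max.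
Qed.

Section weight.
Context {R : realType}.
Variable p : R.
Hypotheses (p1 : 1 < p) (p2 : p <= 2).

(** The sum of the geometric series of ratio 2^(1-p), times 4. *)
Definition carleson_const : R := 4 / (1 - 2 `^ (1 - p)).
(** Up to a constant, t times the sum of the l'^(p-1) over the heights
    l' = l, l/2, l/4, ... that are less than 4t. *)
Definition capped_power (l t : R) : R := t * (Num.min l (4 * t)) `^ (p - 1).
(** The positive part of 4t/l - 1: its integral over an atom bounds the
    measure of the atom when the average of t exceeds l/2. *)
Definition excess (l t : R) : R := Num.max (4 * t / l - 1) 0.

Lemma powR2_lt1 : 2 `^ (1 - p) < 1 :> R.
Proof.
have P1 := p1; rewrite -(opprB p 1) powRN invf_lt1 ?powR_gt0 //.
apply: (@le_lt_trans _ _ (1 `^ (p - 1))); first by rewrite powR1.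
by apply: gt0_ltr_powR; rewrite ?nnegrE //; lra.
Qed.

Lemma carleson_const_gt0 : 0 < carleson_const.
Proof. by rewrite divr_gt0 // subr_gt0 powR2_lt1. Qed.

Lemma capped_power_ge0 l t : 0 <= t -> 0 <= capped_power l t.
Proof. by move=> t0; rewrite mulr_ge0 // powR_ge0. Qed.

Lemma excess_ge0 l t : 0 <= excess l t.
Proof. by rewrite le_max lexx orbT. Qed.

Lemma capped_power_mono l l' t : 0 <= l -> l <= l' -> 0 <= t ->
  capped_power l t <= capped_power l' t.
Proof.
have P1 := p1; move=> l0 ll' t0; rewrite ler_wpM2l //.
apply: ge0_ler_powR.
- by lra.
- by rewrite nnegrE le_min l0 mulr_ge0.
- by rewrite nnegrE le_min (le_trans l0 ll') mulr_ge0.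
- by rewrite le_min !ge_min ll' lexx orbT.
Qed.

(** Passing from height l/2 to height l adds a term to the geometric sum only
    where 4t > l, and only there is the excess positive. *)
Lemma capped_power_step l t : 0 < l -> 0 <= t ->
  l `^ p * excess l t + carleson_const * capped_power (l / 2) t
    <= carleson_const * capped_power l t.
Proof.
have P1 := p1; move=> l0 t0.
have C0 := carleson_const_gt0.
have [tl|lt] := leP (4 * t) l.
  have -> : excess l t = 0.
    by apply/max_idPr; rewrite subr_le0 ler_pdivrMr // mul1r.
  rewrite mulr0 add0r ler_pM2l //; apply: capped_power_mono => //; lra.
have l20 : 0 < l / 2 by rewrite divr_gt0.
have -> : capped_power (l / 2) t = 2 `^ (1 - p) * (t * l `^ (p - 1)).
  rewrite /capped_power (min_idPl _); last by lra.
  rewrite powRM ?(ltW l0) ?invr_ge0 // mulrA mulrC; congr (_ * _).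
  by rewrite -powR_inv1 // -powRrM; congr (_ `^ _); ring.
have -> : capped_power l t = t * l `^ (p - 1) by rewrite /capped_power (min_idPl (ltW lt)).
have ex : l `^ p * excess l t <= 4 * (t * l `^ (p - 1)).
  apply: (@le_trans _ _ (l `^ p * (4 * t / l))).
    rewrite ler_wpM2l ?powR_ge0 // ge_max; apply/andP; split; first by lra.
    by rewrite divr_ge0 ?(ltW l0) // mulr_ge0.
  rewrite -(@mulr_powRB1 _ l p) ?(ltW l0) //; last by lra.
  by rewrite le_eqVlt; apply/orP; left; apply/eqP; field; rewrite gt_eqF.
set Y := t * _ in ex *.
have k : carleson_const * (1 - 2 `^ (1 - p)) = 4.
  by rewrite divfK // gt_eqF // subr_gt0 powR2_lt1.
have : carleson_const * (1 - 2 `^ (1 - p)) * Y = 4 * Y by rewrite k.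
lra.
Qed.

Lemma capped_power_le l t : 0 <= l -> 0 <= t -> capped_power l t <= 4 * t `^ p.
Proof.
have P1 := p1; have P2 := p2; move=> l0 t0.
apply: (@le_trans _ _ (t * (4 * t) `^ (p - 1))).
  rewrite ler_wpM2l //; apply: ge0_ler_powR.
  - by lra.
  - by rewrite nnegrE le_min l0 mulr_ge0.
  - by rewrite nnegrE mulr_ge0.
  - by rewrite ge_min lexx orbT.
rewrite powRM // mulrCA mulr_powRB1 //; last by lra.
rewrite ler_wpM2r ?powR_ge0 //.
apply: (@le_trans _ _ (4 `^ 1)); last by rewrite powRr1.
by apply: ler_powR; [rewrite ler1n|lra].
Qed.

Lemma measurable_excess l : measurable_fun [set: R] (excess l).
Proof.
apply: measurable_maxr => //; apply: measurable_funB => //.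
by apply: measurable_funM => //; apply: measurable_funM.
Qed.

Lemma measurable_capped_power l : measurable_fun [set: R] (capped_power l).
Proof.
apply: measurable_funM => //; apply: (measurableT_comp (measurable_powR _)) => //.
by apply: measurable_minr => //; apply: measurable_funM.
Qed.

End weight.

Section carleson.
Context {d : measure_display} {X : measurableType d} {R : realType}.
Variables (nu mu : {measure set X -> \bar R}).
Variable p : R.
Hypotheses (p1 : 1 < p) (p2 : p <= 2).
Variables (D : set (set X)) (h : set X -> X -> R).
Hypotheses (md : martingale_differences nu D h)
  (mD : forall I, D I -> measurable I) (muD : forall I, D I -> (mu I < +oo)%E).
Local Notation sqint := (square_integral nu p).
Local Notation pint := (power_integral mu p).

Lemma square_integral_subadd h' F G : martingale_differences nu D h' ->
  finite_set F -> F `<=` D ->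
  (sqint h' F <= sqint h' (F `&` G) + sqint h' (F `\` G))%E.
Proof.
have P1 := p1; have P2 := p2; move=> md' finF FD.
have fin1 : finite_set (F `&` G) by exact: finite_setIl.
have fin2 : finite_set (F `\` G) by exact: finite_setD.
have D1 : F `&` G `<=` D by move=> I [/FD].
have D2 : F `\` G `<=` D by move=> I [/FD].
have m1 := measurable_square_sum_powR (p / 2) md' fin1 D1.
have m2 := measurable_square_sum_powR (p / 2) md' fin2 D2.
have m := measurable_square_sum_powR (p / 2) md' finF FD.
have pos K x : [set: X] x -> (0 <= (square_sum h' K x `^ (p / 2))%:E)%E.
  by rewrite lee_fin powR_ge0.
have {}m1 := (measurable_EFinP _ _).2 m1.
have {}m2 := (measurable_EFinP _ _).2 m2.
have {}m := (measurable_EFinP _ _).2 m.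
rewrite /square_integral -(ge0_integralD nu measurableT (pos _) m1 (pos _) m2).
apply: (ge0_le_integral nu measurableT (pos _) m (emeasurable_funD m1 m2)).
move=> x _; rewrite -EFinD lee_fin.
have -> : square_sum h' F x = square_sum h' (F `&` G) x + square_sum h' (F `\` G) x.
  by rewrite /square_sum (fsbigID G).
by apply: powR_subadd; rewrite ?square_sum_ge0 //; lra.
Qed.

(** The members of G below a maximal member J are estimated together by the
    hypothesis for J; the remaining ones are disjoint from J. *)
Lemma square_integral_cover (psi : X -> R) (T : R) G :
  0 <= T -> measurable_fun setT psi -> (forall x, 0 <= psi x) ->
  finite_set G -> G `<=` D ->
  (forall J F, G J -> finite_set F -> F `<=` [set I | D I /\ I `<=` J] ->
    (sqint h F <= T%:E * \int[mu]_(x in J) (psi x)%:E)%E) ->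
  (sqint h G <= T%:E * \int[mu]_x (psi x)%:E)%E.
Proof.
move=> T0 mpsi psi0 finG GD test.
have pos (A : set X) x : A x -> (0 <= (psi x)%:E)%E by rewrite lee_fin.
have mE (A : set X) : measurable_fun A (EFin \o psi).
  by apply: measurable_funTS; exact/measurable_EFinP.
have mU F : finite_set F -> F `<=` D -> measurable (\bigcup_(I in F) I).
  by move=> finF FD; apply: fin_bigcup_measurable => // I /FD; exact: mD.
apply: (@le_trans _ _ (T%:E * \int[mu]_(x in \bigcup_(I in G) I) (psi x)%:E)%E); last first.
  apply: lee_wpmul2l; first by rewrite lee_fin.
  exact: (ge0_subset_integral mu (mU _ finG GD) measurableT (mE _) (pos _) (@subsetT _ _)).
have [n] := ubnP #|` fset_set G|.
elim: n => // n IH in G finG GD test *; rewrite ltnS => Gn.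
have [->|G0] := eqVneq G set0.
  rewrite bigcup_set0 integral_set0 mule0 /square_integral integral0_eq // => x _.
  have P1 := p1.
  by rewrite /square_sum fsbig_set0 powR0 // gt_eqF //; lra.
have [J GJ Jmax] := finite_set_maximal finG ((set0P _).1 G0).
pose GJ' := [set I | I `<=` J].
have finG' : finite_set (G `\` GJ') by exact: finite_setD.
have finGJ : finite_set (G `&` GJ') by exact: finite_setIl.
have G'D : G `\` GJ' `<=` D by move=> I [/GD].
have disj : [disjoint J & \bigcup_(I in G `\` GJ') I].
  apply/disj_setPS => x [Jx [I [GI nIJ] Ix]].
  have [JI|IJ] := md_nested md (GD _ GJ) (GD _ GI) (ex_intro _ x (conj Jx Ix)).
    by apply: nIJ; rewrite (Jmax _ GI JI); exact: subset_refl.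
  exact: nIJ.
have -> : \bigcup_(I in G) I = J `|` \bigcup_(I in G `\` GJ') I.
  apply/seteqP; split=> [x [I GI Ix]|x [Jx|[I [GI _] Ix]]]; last 2 first.
  - by exists J.
  - by exists I.
  have [IJ|nIJ] := pselect (I `<=` J); first by left; exact: IJ.
  by right; exists I.
rewrite (ge0_integral_setU mu (mD (GD _ GJ)) (mU _ finG' G'D) (mE _) (pos _) disj).
rewrite ge0_muleDr; [|exact/integral_ge0/pos|exact/integral_ge0/pos].
apply: (le_trans (square_integral_subadd GJ' md finG GD)).
apply: leeD.
  by apply: test => // I [GI IJ]; split => //; exact: GD.
apply: IH => //.
  by move=> K F [GK _]; exact: test.
apply: leq_trans Gn.
apply: fproper_ltn_card; rewrite fproperEneq; apply/andP; split; last first.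
  by rewrite -fset_set_sub //; exact: subDsetl.
apply/eqP => E; have : J \in fset_set (G `\` GJ') by rewrite E in_fset_set // inE.
by rewrite in_fset_set // inE => -[_]; apply; exact: subset_refl.
Qed.

Variables (f : X -> R).
Hypotheses (lf : f \in Lfun mu p%:E).

Lemma Lfun_integrable_on (I : set X) : measurable I -> (mu I < +oo)%E ->
  mu.-integrable I (EFin \o f).
Proof.
have P1 := p1; move=> mI muI.
have mf := Lfun_measurable lf.
have ip := integrableS measurableT mI (@subsetT _ I) (Lfun_integrable (ltW P1) lf).
have i1 : mu.-integrable I (EFin \o cst (1 : R)).
  by apply: measurable_bounded_integrable => //; exists `|1|; split => // y ay x _; exact: ltW.
have := integrableD mI i1 ip; apply: le_integrable => //.
  by apply: measurable_funTS; exact/measurable_EFinP.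
move=> x _ /=; rewrite lee_fin.
rewrite [leRHS]ger0_norm ?addr_ge0 ?powR_ge0 //.
have [fx|fx] := leP `|f x| 1; first by rewrite (le_trans fx) // lerDl powR_ge0.
apply: (@le_trans _ _ (`|f x| `^ p)); last by rewrite lerDr.
by apply: le1r_powR; lra.
Qed.

(** Compare l/2 * mu(I) < int_I |f| with |f| <= l/4 * (excess + 1). *)
Lemma measure_le_excess (l : R) I : 0 < l -> D I -> l / 2 < `|average mu f I| ->
  (mu I <= \int[mu]_(x in I) (excess l `|f x|)%:E)%E.
Proof.
move=> l0 DI; rewrite /average => big.
have mI := mD DI; have fI : mu I \is a fin_num by rewrite ge0_fin_numE // muD.
have iF := Lfun_integrable_on mI (muD DI).
have m0 : 0 < fine (mu I).
  rewrite lt0r fine_ge0 // andbT; apply: contraTneq big => ->.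
  by rewrite invr0 mul0r normr0 -leNgt divr_ge0 ?(ltW l0).
have mf := Lfun_measurable lf.
have mex : measurable_fun [set: X] (fun x => excess l `|f x|).
  by apply: (measurableT_comp (measurable_excess l)); exact: measurableT_comp.
have mexI : measurable_fun I (fun x => (excess l `|f x|)%:E).
  by apply: measurable_funTS; exact/measurable_EFinP.
have [->|exfin] := eqVneq (\int[mu]_(x in I) (excess l `|f x|)%:E)%E +oo%E.
  by rewrite leey.
have iex : mu.-integrable I (EFin \o (fun x => excess l `|f x|)).
  apply/integrableP; split => //.
  rewrite (eq_integral (fun x => (excess l `|f x|)%:E)) ?ltey // => x _ /=.
  by rewrite ger0_norm // excess_ge0.
have i1 : mu.-integrable I (EFin \o cst (1 : R)).
  by apply: measurable_bounded_integrable => //; [exact: muD|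
    exists `|1|; split => // y ay x _; exact: ltW].
have exE := fineK (integrable_fin_num mI iex); rewrite -exE -(fineK fI) lee_fin.
set e := fine _ in exE *; set m := fine (mu I) in m0 big *.
have le1 : `|\int[mu]_(x in I) f x| <= l / 4 * (e + m).
  apply: (le_trans (le_normr_Rintegral mI iF)).
  have <- : \int[mu]_(x in I) (l / 4 * (excess l `|f x| + 1)) = l / 4 * (e + m).
    rewrite RintegralZl //; last exact: (integrableD mI iex i1).
    by rewrite RintegralD // Rintegral_cst // mul1r.
  apply: le_Rintegral => //.
  - exact: integrable_norm iF.
  - exact: (integrableZl mI (l / 4) (integrableD mI iex i1)).
  move=> x _.
  have : 4 * `|f x| / l <= excess l `|f x| + 1 by rewrite -lerBlDr le_max lexx.
  rewrite ler_pdivrMr //; lra.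
have : l / 2 * m < `|\int[mu]_(x in I) f x|.
  have mV : 0 <= m^-1 by rewrite invr_ge0 ltW.
  by move: big; rewrite normrM (ger0_norm mV) ltr_pdivlMl // (mulrC m).
move=> b; have {}b := lt_le_trans b le1.
have : l / 4 * m <= l / 4 * e by lra.
by rewrite ler_pM2l // divr_gt0.
Qed.

Variable T : R.
Hypotheses (T0 : 0 <= T)
  (test : forall J F, D J -> finite_set F -> F `<=` [set I | D I /\ I `<=` J] ->
    (sqint h F <= T%:E * mu J)%E).

Let a I := average mu f I.
Let ah I x := a I * h I x.

Let mdah : martingale_differences nu D ah.
Proof. exact: scale_martingale_differences. Qed.

Lemma square_integral_level l G : 0 < l -> finite_set G -> G `<=` D ->
  (forall I, G I -> l / 2 < `|a I| <= l) ->
  (sqint ah G <= T%:E * \int[mu]_x (l `^ p * excess l `|f x|)%:E)%E.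
Proof.
have P1 := p1; move=> l0 finG GD Gl.
have mf := Lfun_measurable lf.
have mex : measurable_fun [set: X] (fun x => excess l `|f x|).
  by apply: (measurableT_comp (measurable_excess l)); exact: measurableT_comp.
have lp0 : 0 <= l `^ p by exact: powR_ge0.
have exE : (\int[mu]_x (l `^ p * excess l `|f x|)%:E =
    (l `^ p)%:E * \int[mu]_x (excess l `|f x|)%:E)%E.
  rewrite -ge0_integralZl_EFin //; last exact/measurable_EFinP.
  by move=> x _; rewrite lee_fin excess_ge0.
apply: (@le_trans _ _ ((l `^ p)%:E * sqint h G)%E).
  have mG := measurable_square_sum_powR (p / 2) md finG GD.
  have mah := measurable_square_sum_powR (p / 2) mdah finG GD.
  have pos h' x : [set: X] x -> (0 <= (square_sum h' G x `^ (p / 2))%:E)%E.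
    by rewrite lee_fin powR_ge0.
  have {}mG := (measurable_EFinP _ _).2 mG.
  have {}mah := (measurable_EFinP _ _).2 mah.
  rewrite /square_integral -(ge0_integralZl_EFin nu measurableT (pos h) mG lp0).
  apply: ge0_le_integral => //.
  - exact: pos.
  - exact: measurable_funeM.
  move=> x _; rewrite -EFinM lee_fin.
  have -> : l `^ p = (l ^+ 2) `^ (p / 2) by rewrite -normr_powR gtr0_norm.
  rewrite -powRM ?sqr_ge0 ?square_sum_ge0 //.
  have ls0 : 0 <= l ^+ 2 * square_sum h G x.
    by apply: mulr_ge0; [exact: sqr_ge0|exact: square_sum_ge0].
  apply: ge0_ler_powR; rewrite ?nnegrE ?square_sum_ge0 //; first by lra.
  rewrite /square_sum !fsbig_finite //= mulr_sumr big_seq [leRHS]big_seq.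
  apply: ler_sum => I IG; rewrite exprMn ler_wpM2r ?sqr_ge0 //.
  rewrite -(real_normK (num_real (a I))) ler_pXn2r ?nnegrE ?(ltW l0) //.
  by have /Gl/andP[] : G I by rewrite in_fset_set // inE in IG.
rewrite exE muleCA; apply: lee_wpmul2l; first by rewrite lee_fin.
apply: square_integral_cover => // [x|J F GJ finF FJ]; first exact: excess_ge0.
apply: (le_trans (test (GD _ GJ) finF FJ)); apply: lee_wpmul2l; first by rewrite lee_fin.
by apply: measure_le_excess => //; [exact: GD|case/andP: (Gl _ GJ)].
Qed.

(** Induction on the number of atoms: if l is the largest average, the atoms
    with average above l/2 form one height, and those left have averages at
    most l/2. *)
Lemma square_integral_capped n F l : (#|` fset_set F| <= n)%N ->
  0 <= l -> finite_set F -> F `<=` D -> (forall I, F I -> `|a I| <= l) ->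
  (sqint ah F <= T%:E * \int[mu]_x (carleson_const p * capped_power p l `|f x|)%:E)%E.
Proof.
have P1 := p1; have P2 := p2.
have C0 := carleson_const_gt0 p1.
have mf := Lfun_measurable lf.
have mW l' : measurable_fun [set: X] (fun x => (carleson_const p * capped_power p l' `|f x|)%:E).
  apply/measurable_EFinP; apply: measurable_funM => //.
  by apply: (measurableT_comp (measurable_capped_power p l')); exact: measurableT_comp.
have W0 l' x : (0 <= (carleson_const p * capped_power p l' `|f x|)%:E)%E.
  by rewrite lee_fin mulr_ge0 ?capped_power_ge0 // ltW.
have trivial_case F' l' : (forall I, F' I -> a I = 0) ->
    (sqint ah F' <= T%:E * \int[mu]_x (carleson_const p * capped_power p l' `|f x|)%:E)%E.
  move=> a0; rewrite /square_integral integral0_eq.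
    by apply: mule_ge0; [rewrite lee_fin|exact: integral_ge0].
  move=> x _; rewrite (_ : square_sum _ _ _ = 0) ?powR0 //; first by rewrite gt_eqF //; lra.
  by apply: fsbig1 => I FI; rewrite /ah a0 // mul0r expr0n.
elim: n F l => [|n IH] F l Fn l0 finF FD Fl.
  apply: trivial_case => I FI.
  have : I \in fset_set F by rewrite in_fset_set // inE.
  by move: Fn; rewrite leqn0 cardfs_eq0 => /eqP ->.
have [F0|F0] := eqVneq F set0; first by apply: trivial_case; rewrite F0.
have [I0 FI0 I0max] := finite_set_argmax (fun I => `|a I|) finF ((set0P _).1 F0).
set l0' := `|a I0|.
have [l00|l00] := eqVneq l0' 0.
  apply: trivial_case => I FI; apply/eqP; rewrite -normr_eq0 eq_le normr_ge0 andbT -l00.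
  exact: I0max.
have lp : 0 < l0' by rewrite lt0r l00 normr_ge0.
pose G := [set I | l0' / 2 < `|a I|].
apply: (le_trans (square_integral_subadd G mdah finF FD)).
have lev : (sqint ah (F `&` G) <= T%:E * \int[mu]_x (l0' `^ p * excess l0' `|f x|)%:E)%E.
  apply: square_integral_level => //; first exact: finite_setIl.
    by move=> I [/FD].
  by move=> I [FI GI]; rewrite GI /=; exact: I0max.
have rest : (sqint ah (F `\` G) <=
    T%:E * \int[mu]_x (carleson_const p * capped_power p (l0' / 2) `|f x|)%:E)%E.
  apply: IH => //.
  - rewrite -ltnS; apply: leq_trans Fn; apply: fproper_ltn_card.
    have finFG : finite_set (F `\` G) by exact: finite_setD.
    rewrite fproperEneq; apply/andP; split; last first.
      by rewrite -fset_set_sub //; exact: subDsetl.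
    apply/eqP => E; have : I0 \in fset_set (F `\` G) by rewrite E in_fset_set // inE.
    by rewrite in_fset_set // inE => -[_]; apply; rewrite /G /= -/l0'; lra.
  - by rewrite divr_ge0 ?(ltW lp).
  - exact: finite_setD.
  - by move=> I [/FD].
  - by move=> I [_ /negP]; rewrite -leNgt.
apply: (le_trans (leeD lev rest)).
have mex : measurable_fun [set: X] (fun x => (l0' `^ p * excess l0' `|f x|)%:E).
  apply/measurable_EFinP; apply: measurable_funM => //.
  by apply: (measurableT_comp (measurable_excess l0')); exact: measurableT_comp.
have ex0 x : (0 <= (l0' `^ p * excess l0' `|f x|)%:E)%E.
  by rewrite lee_fin mulr_ge0 ?powR_ge0 ?excess_ge0.
rewrite -ge0_muleDr; [|by apply: integral_ge0|by apply: integral_ge0].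
rewrite -(ge0_integralD mu measurableT (fun x _ => ex0 x) mex (fun x _ => W0 _ x) (mW _)).
apply: lee_wpmul2l; first by rewrite lee_fin.
apply: (ge0_le_integral mu measurableT _ (emeasurable_funD mex (mW _)) (mW l)).
  by move=> x _; apply: adde_ge0.
move=> x _; rewrite -EFinD lee_fin.
apply: (le_trans (capped_power_step p1 lp (normr_ge0 (f x)))).
rewrite ler_pM2l //; apply: capped_power_mono => //; first exact: ltW.
exact: Fl.
Qed.

Lemma carleson_embedding F : finite_set F -> F `<=` D ->
  (sqint ah F <= (T * (4 * carleson_const p))%:E * pint f)%E.
Proof.
move=> finF FD.
have C0 := carleson_const_gt0 p1.
have mf := Lfun_measurable lf.
have [l l0 Fl] : exists2 l, 0 <= l & forall I, F I -> `|a I| <= l.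
  have [->|F0] := eqVneq F set0; first by exists 0.
  have [I0 _ I0max] := finite_set_argmax (fun I => `|a I|) finF ((set0P _).1 F0).
  by exists `|a I0|.
apply: (le_trans (square_integral_capped (leqnn _) l0 finF FD Fl)).
rewrite EFinM -muleA; apply: lee_wpmul2l; first by rewrite lee_fin.
have mp := measurable_EFin_norm_powR p mf.
rewrite /power_integral -ge0_integralZl_EFin //; last by rewrite mulr_ge0 // ltW.
apply: ge0_le_integral => //.
- by move=> x _; rewrite lee_fin mulr_ge0 ?capped_power_ge0 // ltW.
- apply/measurable_EFinP; apply: measurable_funM => //.
  by apply: (measurableT_comp (measurable_capped_power p l)); exact: measurableT_comp.
- exact: measurable_funeM.
move=> x _; rewrite -EFinM lee_fin (mulrC 4 (carleson_const p)) -(mulrA (carleson_const p)) ler_pM2l //.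
exact: capped_power_le.
Qed.

End carleson.

(** * Two weight paraproducts *)

Section paraproducts.
Context {d : measure_display} {X : measurableType d} {R : realType}.
Variables (S L : int -> set (set X)) (mu nu : {measure set X -> \bar R}).
Variables (b : symbol X R) (p : R).
Hypotheses (p1 : 1 < p) (p2 : p <= 2).
Hypotheses (af : atomic_filtration S L) (lfmu : locally_finite L mu)
  (lfnu : locally_finite L nu) (sb : is_symbol L nu b)
  (van : vanishes_on_null_atoms L mu nu b).
Local Notation k1 := (5 / (p - 1) ^+ 2).
Local Notation Delta := (delta L nu b).

Lemma eq_uncond_sum (D : set (set X)) (h h' : set X -> X -> R) s :
  (forall I, D I -> h I = h' I) -> uncond_sum nu p D h s -> uncond_sum nu p D h' s.
Proof.
move=> hh' [hL sL cv]; split => // [I DI|eps e0]; first by rewrite -hh' //; exact: hL.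
have [F0 [finF0 F0D HF0]] := cv eps e0.
exists F0; split => // F finF F0F FD; have := HF0 F finF F0F FD.
rewrite (_ : EFin \o _ = EFin \o (fun x => (\sum_(I \in F) h' I x - s x)%R)) //.
apply/funext => x /=; congr (_ - _)%:E.
by apply: eq_fsbigr => I /set_mem /FD DI; rewrite hh'.
Qed.

(** The common ground of the two kinds of symbols: all later statements about
    paraproducts rest on this property of the differences. *)
Lemma delta_martingale_differences : martingale_differences nu (atoms L) Delta.
Proof.
case: b sb => [f|g] /= sb'.
  split.
  - by move=> I x atI; exact: mdiff_off.
  - by move=> I K; exact: (atoms_nested af).
  - move=> I K x y atI atK KI nKI Kx Ky.
    have [I' ch KI'] := proper_atom_in_child (R := R) af atI atK KI nKI.
    by rewrite /= !(mdiff_on_child af atI nu f ch) //; exact: KI'.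
  - by move=> I atI; apply: (mdiff_mean_zero af) => //; exact: sb'.
split.
- by move=> I x; exact: (mdf_support sb').
- by move=> I K; exact: (atoms_nested af).
- move=> I K x y atI atK KI nKI Kx Ky.
  have [I' ch KI'] := proper_atom_in_child (R := R) af atI atK KI nKI.
  by apply: (mdf_const sb' atI ch); exact: KI'.
- move=> I atI; have ig := mdf_integrable sb' atI.
  have mI := atom_measurable af atI.
  split => //.
  have igI := integrableS measurableT mI (@subsetT _ I) ig.
  transitivity (\int[nu]_(x in I) (g I x)%:E)%E.
    rewrite [RHS]integral_mkcond; apply: eq_integral => x _.
    rewrite patchE; case: ifPn => // /negP; rewrite inE => nIx.
    by rewrite /= (mdf_support sb').
  rewrite -(fineK (integrable_fin_num mI igI)); congr EFin.
  exact: (mdf_mean0 sb' atI).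
Qed.

Lemma paraproduct_summand (f : X -> R) I : atoms L I ->
  (fun x => expect mu f I x * Delta I x) = (fun x => average mu f I * Delta I x).
Proof.
move=> atI; apply/funext => x; rewrite /expect -mulrA; congr (_ * _).
have [Ix|nIx] := pselect (I x); first by rewrite indicE mem_set // mul1r.
by rewrite (md_off delta_martingale_differences) // mulr0.
Qed.

Lemma testing_square_integral B J F : testing_bound L mu nu b p B -> atoms L J ->
  finite_set F -> F `<=` [set I | atoms L I /\ I `<=` J] ->
  (square_integral nu p Delta F <= (2 * k1 * B `^ p)%:E * mu J)%E.
Proof.
have P1 := p1; move=> tb atJ finF FJ.
have [s us sB] := tb J atJ.
have md : martingale_differences nu (atoms_in L J) Delta.
  by apply: sub_martingale_differences delta_martingale_differences => I [].
have off I x : atoms_in L J I -> ~ J x -> Delta I x = 0.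
  by move=> [atI IJ] nJx; apply: (md_off delta_martingale_differences) => // /IJ.
apply: (le_trans (square_integral_le_uncond_sum p1 p2 md (atom_measurable af atJ) off us finF FJ)).
rewrite (EFinM (2 * k1)) -[leRHS]muleA; apply: lee_wpmul2l => //.
by rewrite lee_fin mulr_ge0 // divr_ge0 // sqr_ge0.
Qed.

Definition sufficiency_const : R := (40 * k1 * carleson_const p) `^ p^-1.
Definition necessity_const : R := (10 * k1) `^ p^-1.

Let k1_gt0 : 0 < k1.
Proof. by have P1 := p1; rewrite divr_gt0 // exprn_gt0 //; lra. Qed.

Lemma sufficiency_const_gt0 : 0 < sufficiency_const.
Proof. by rewrite powR_gt0 // mulr_gt0 ?carleson_const_gt0 // mulr_gt0. Qed.

Lemma necessity_const_gt0 : 0 < necessity_const.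
Proof. by rewrite powR_gt0 // mulr_gt0. Qed.

Let powRVp (c x : R) : 0 <= c -> 0 <= x -> (c `^ p^-1 * x) `^ p = c * x `^ p.
Proof.
have P1 := p1; move=> c0 x0; rewrite powRM ?powR_ge0 // -powRrM mulVf ?powRr1 //.
by rewrite gt_eqF //; lra.
Qed.

Lemma testing_implies_paraproduct_bound B : 0 <= B -> testing_bound L mu nu b p B ->
  paraproduct_bound L mu nu b p (sufficiency_const * B).
Proof.
have P1 := p1; move=> B0 tb f lf.
pose T := 2 * k1 * B `^ p.
have T0 : 0 <= T by rewrite mulr_ge0 ?powR_ge0 // mulr_ge0 // ltW.
have C0 := carleson_const_gt0 p1.
have md := delta_martingale_differences.
have [mf fint] := (Lfun_power_integral mu p1 f).1 lf.
have finf : power_integral mu p f = (fine (power_integral mu p f))%:E.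
  by rewrite fineK // ge0_fin_numE // power_integral_ge0.
set N := fine _ in finf.
pose M := T * (4 * carleson_const p) * N.
have bound F : finite_set F -> F `<=` atoms L ->
    (square_integral nu p (fun I x => average mu f I * Delta I x)%R F <= M%:E)%E.
  move=> finF FD; rewrite /M EFinM -finf.
  apply: (carleson_embedding p1 p2 md _ lfmu lf T0) => //.
    by move=> I atI; exact: (atom_measurable af atI).
  by move=> J G atJ finG GJ; exact: testing_square_integral.
have [s us sM] := uncond_sum_of_square_integral p1 p2
  (scale_martingale_differences (average mu f) md) bound.
exists s.
  apply: eq_uncond_sum us => I atI; exact/esym/paraproduct_summand.
rewrite !Lnorm_power_integral // finf -EFinM; apply: (le_trans sM); rewrite lee_fin.
rewrite /sufficiency_const powRVp //; last first.
  by apply: mulr_ge0; [apply: mulr_ge0 => //; exact: ltW|exact: ltW].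
by rewrite /M /T le_eqVlt; apply/orP; left; apply/eqP; ring.
Qed.

(** The hypothesis on null atoms enters here: the average of an
    indicator over a null atom is 0 instead of 1. *)
Lemma paraproduct_implies_testing_bound A : 0 <= A -> paraproduct_bound L mu nu b p A ->
  testing_bound L mu nu b p (necessity_const * A).
Proof.
have P1 := p1; move=> A0 pb J atJ.
have P0 : p != 0 by rewrite gt_eqF //; lra.
have mJ := atom_measurable af atJ.
have md := delta_martingale_differences.
have int1 : power_integral mu p (\1_J : X -> R) = mu J.
  transitivity (\int[mu]_x (\1_J x)%:E)%E; last by rewrite integral_indic // setIT.
  apply: eq_integral => x _; rewrite indicE.
  by case: (x \in J); rewrite /= ?normr0 ?powR0 // normr1 powR1.
have l1 : (\1_J : X -> R) \in Lfun mu p%:E.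
  apply/(Lfun_power_integral mu p1); split; first exact: measurable_indic.
  by rewrite int1; exact: lfmu.
have [s us sA] := pb _ l1; rewrite !Lnorm_power_integral // int1 in sA.
have {}us : uncond_sum nu p (atoms L) (fun I x => average mu \1_J I * Delta I x) s.
  by apply: eq_uncond_sum us => I atI; exact: paraproduct_summand.
have mdJ : martingale_differences nu (atoms_in L J) Delta.
  by apply: sub_martingale_differences md => I [].
have muJ : mu J = (fine (mu J))%:E by rewrite fineK // ge0_fin_numE //; exact: lfmu.
pose M := 2 * k1 * (A `^ p * fine (mu J)).
have bound F : finite_set F -> F `<=` atoms_in L J -> (square_integral nu p Delta F <= M%:E)%E.
  move=> finF FJ.
  have FD : F `<=` atoms L by move=> I /FJ[].
  have mdah := scale_martingale_differences (average mu \1_J) md.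
  have off I x : atoms L I -> ~ [set: X] x -> average mu \1_J I * Delta I x = 0 by move=> _ [].
  have := square_integral_le_uncond_sum p1 p2 mdah measurableT off us finF FD.
  move=> H.
  apply: (@le_trans _ _ (square_integral nu p (fun I x => average mu \1_J I * Delta I x)%R F)).
    have m1 := (measurable_EFinP _ _).2 (measurable_square_sum_powR (p / 2) md finF FD).
    have m2 := (measurable_EFinP _ _).2 (measurable_square_sum_powR (p / 2) mdah finF FD).
    have pos h x : [set: X] x -> (0 <= (square_sum h F x `^ (p / 2))%:E)%E.
      by rewrite lee_fin powR_ge0.
    apply: (ae_ge0_le_integral measurableT (pos _) m1 (pos _) m2).
    have : {ae nu, forall x, (\bigcap_(I in [set` fset_set F])
        [set x | mu I = 0%E -> Delta I x = 0]) x}.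
      apply: filter_bigI => I; rewrite in_fset_set // inE => FI.
      have [I0|I0] := pselect (mu I = 0%E); last by apply: filterE => x.
      by apply: filterS (van (FD _ FI) I0) => x Dx _.
    apply: filterS => x vx _; rewrite lee_fin.
    apply: ge0_ler_powR; rewrite ?nnegrE ?square_sum_ge0 //; first by lra.
    rewrite le_eqVlt; apply/orP; left; apply/eqP.
    apply: eq_fsbigr => I /set_mem FI.
    have [I0|I0] := pselect (mu I = 0%E).
      by rewrite (vx I) ?mulr0 //= in_fset_set // inE.
    rewrite (_ : average mu \1_J I = 1) ?mul1r //.
    have [atI IJ] := FJ _ FI.
    have mI := atom_measurable af atI.
    have finI : mu I \is a fin_num by rewrite ge0_fin_numE //; exact: lfmu.
    rewrite /average /Rintegral integral_indic // (setIidr IJ).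
    by rewrite mulVf // fine_eq0 //; exact/eqP.
  apply: (le_trans H); rewrite /M (EFinM (2 * k1)); apply: lee_wpmul2l.
    by rewrite lee_fin mulr_ge0 // ltW.
  by rewrite EFinM -muJ.
have [s' us' sM'] := uncond_sum_of_square_integral p1 p2 mdJ bound.
exists s' => //.
have ms' : measurable_fun setT s' by case: us' => _ /Lfun_measurable.
apply: (@le_trans _ _ (power_integral nu p s')).
  have pos x : [set: X] x -> (0 <= (`|s' x| `^ p)%:E)%E by rewrite lee_fin powR_ge0.
  exact: (ge0_subset_integral nu mJ measurableT
    (measurable_EFin_norm_powR p ms') pos (@subsetT _ J)).
apply: (le_trans sM'); rewrite muJ -EFinM lee_fin.
rewrite /necessity_const powRVp //; last by rewrite mulr_ge0 // ltW.
by rewrite /M le_eqVlt; apply/orP; left; apply/eqP; ring.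
Qed.


End paraproducts.

Section best_constants.
Context {R : realType}.
Implicit Types (P Q : R -> Prop) (c : R).

Lemma best_const_ge0 P : (0 <= best_const P)%E.
Proof. by apply: le_ereal_inf_tmp => _ [A [A0 _] <-]; rewrite lee_fin. Qed.

Lemma best_const_le c P Q : 0 < c -> (forall A, 0 <= A -> P A -> Q (c * A)) ->
  (best_const Q <= c%:E * best_const P)%E.
Proof.
move=> c0 PQ; rewrite -lee_pdivrMl //.
apply: le_ereal_inf_tmp => _ [A [A0 PA] <-].
rewrite lee_pdivrMl // -EFinM; apply: ereal_inf_lbound.
by exists (c * A) => //; split; [rewrite mulr_ge0 // ltW|exact: PQ].
Qed.

End best_constants.

Theorem theorem1p3 (R : realType) (p : R) (hp1 : 1 < p) (hp2 : p <= 2) :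
  exists c C : R, [/\ 0 < c, c <= C &
    forall (d : measure_display) (X : measurableType d)
      (S L : int -> set (set X)) (mu nu : {measure set X -> \bar R})
      (b : symbol X R),
      atomic_filtration S L ->
      sigma_finite [set: X] mu ->
      locally_finite L mu -> locally_finite L nu ->
      is_symbol L nu b ->
      vanishes_on_null_atoms L mu nu b ->
      ((exists A : R, 0 <= A /\ paraproduct_bound L mu nu b p A) <->
       (exists B : R, 0 <= B /\ testing_bound L mu nu b p B)) /\
      (c%:E * best_const (testing_bound L mu nu b p)
         <= best_const (paraproduct_bound L mu nu b p)
         <= C%:E * best_const (testing_bound L mu nu b p))%E].
Proof.
have n0 := necessity_const_gt0 hp1; have s0 := sufficiency_const_gt0 hp1.
exists (necessity_const p)^-1, (Num.max (necessity_const p)^-1 (sufficiency_const p)).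
split; [by rewrite invr_gt0|by rewrite le_max lexx|].
move=> d X S L mu nu b af _ lfmu lfnu sb van.
have nec := paraproduct_implies_testing_bound hp1 hp2 af lfmu lfnu sb van.
have suf := testing_implies_paraproduct_bound hp1 hp2 af lfmu lfnu sb.
split.
  split=> [[A [A0 PA]]|[B [B0 PB]]].
    by exists (necessity_const p * A); split; [rewrite mulr_ge0 // ltW|exact: nec].
  by exists (sufficiency_const p * B); split; [rewrite mulr_ge0 // ltW|exact: suf].
apply/andP; split; first by rewrite lee_pdivrMl //; exact: best_const_le.
apply: (le_trans (best_const_le s0 suf)).
by apply: lee_wpmul2r; [exact: best_const_ge0|rewrite lee_fin le_max lexx orbT].
Qed.
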